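(* Let $m\ge 2$ and $\alpha\le 0$. Let $X$ and $Y$ be bodies in $\mathbb{R}^m$. Suppose that the complement $Y^c$ satisfies the uniform boundary inner cone condition of aperture angle $\kappa$ and height $\delta$, where $0<\kappa\le\pi$ and $0<\delta\le+\infty$. Let $0<R_0<\operatorname{diam}Y$, and let $\tilde R=\tilde R(\alpha,\kappa,\delta,\operatorname{diam}Y,R_0)$. Then for any points $x\in X$ with $\operatorname{dist}(x,X^c)\ge R_0$ and $y$ in the interior of $Y$ with $\operatorname{dist}(y,Y^c)\le\tilde R$, we have $V_Y^{(\alpha)}(y)<V_X^{(\alpha)}(x)$.
   Context: A body in $\mathbb{R}^m$ is the closure of a bounded open set. $X^c$ is the complement of $X$, $B_\rho(x)$ the closed ball of radius $\rho$ centered at $x$, and $\sigma$ the $(m-1)$-dimensional spherical Lebesgue measure. Renormalized Riesz potential: for a body $\Omega$ and an interior point $x$ of $\Omega$, $V_\Omega^{(\alpha)}(x)=\lim_{\varepsilon\to0^+}\left(\int_{\Omega\setminus B_\varepsilon(x)}|x-\xi|^{\alpha-m}d\xi-\frac{\sigma(S^{m-1})}{-\alpha}\varepsilon^{\alpha}\right)$ if $\alpha<0$, and $V_\Omega^{(0)}(x)=\lim_{\varepsilon\to0^+}\left(\int_{\Omega\setminus B_\varepsilon(x)}|x-\xi|^{-m}d\xi-\sigma(S^{m-1})\log\frac1\varepsilon\right)$ if $\alpha=0$. The open cone of vertex $x$, axis direction $v\in S^{m-1}$, aperture angle $\kappa$ and height $\delta$ is $\{x+\rho w: 0<\rho<\delta,\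 w\in S^{m-1},\ w\cdot v>\cos(\kappa/2)\}$. An open set $U\subset\mathbb{R}^m$ satisfies the uniform boundary inner cone condition of aperture angle $\kappa$ and height $\delta$ if for each $x\in\partial U$ there is an open cone of vertex $x$, aperture angle $\kappa$ and height $\delta$ (some axis direction) contained in $U$. Definition of $\tilde R$: let $C_\theta(x;\kappa,\delta)$ be the open cone of vertex $x$, axis direction $\cos\theta\, e_1+\sin\theta\, e_m$, aperture angle $\kappa$ and height $\delta$. For $D>0$ and $0<R_0<D$ put, for $R>0$, $E(R)=\min_{0\le\theta\le(\pi-\kappa)/2}\left(\int_{C_\theta(Re_1;\kappa,\delta)\cap B_D(0)}|\xi|^{\alpha-m}d\xi-\int_{B_D(0)\setminus B_{R_0}(0)}|\xi|^{\alpha-m}d\xi\right).$ There is a unique positive number $\tilde R=\tilde R(\alpha,\kappa,\delta,D,R_0)$ with $E(\tilde R)=0$; moreover $E(R)>0$ for $R<\tilde R$, $E(R)<0$ for $R>\tilde R$, and $\tilde R<R_0$. *)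

(* Defs.v *)
From HB Require Import structures.
From mathcomp Require Import all_boot all_order all_algebra.
From mathcomp Require Import all_classical all_reals all_analysis.

Set Implicit Arguments.
Unset Strict Implicit.
Unset Printing Implicit Defensive.

Import Order.TTheory GRing.Theory Num.Theory.
Import numFieldNormedType.Exports.

Local Open Scope classical_set_scope.
Local Open Scope ring_scope.

(* R^m is 'rV[R]_m. The library topology on 'rV[R]_m is the usual one, but the
   library norm `|u| is the sup norm; [enorm] is the Euclidean norm. *)

Section Euclid.
Context {R : realType} {m : nat}.
Implicit Types (u v x : 'rV[R]_m) (A : set 'rV[R]_m).

Definition dot u v : R := \sum_(i < m) u 0 i * v 0 i.

Definition enorm u : R := Num.sqrt (dot u u).

(* [inf] and [sup] are real valued; below, A is always nonempty in [dist_set]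
   and nonempty bounded in [diam]. *)
Definition dist_set x A : R := inf [set enorm (x - a) | a in A].

Definition diam A : R := sup [set enorm (p.1 - p.2) | p in A `*` A].

Definition cball (rho : R) x : set 'rV[R]_m :=
  [set xi | enorm (xi - x) <= rho].

Definition unit_sphere : set 'rV[R]_m := [set w | enorm w = 1].

Definition frontier A : set 'rV[R]_m := closure A `\` A°.

Definition body A : Prop :=
  exists U : set 'rV[R]_m, [/\ open U, bounded_set U & A = closure U].

Definition open_cone x v (kappa : R) (delta : \bar R) : set 'rV[R]_m :=
  [set x + rho *: w | rho in [set rho : R | 0 < rho /\ (rho%:E < delta)%E]
                    & w in [set w | unit_sphere w /\ cos (kappa / 2) < dot w v]].

Definition inner_cone_condition A (kappa : R) (delta : \bar R) : Prop :=
  forall x, frontier A x ->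
    exists v, unit_sphere v /\ open_cone x v kappa delta `<=` A.

End Euclid.

(* The sigma-algebra on R^n generated by the coordinates (the Borel sets). *)
Section measurable_rV.
Context {R : realType} (n : nat).

Let coors : 'I_n -> 'rV[R]_n -> R := fun i u => u 0 i.

Let rV_set0 : g_sigma_preimage coors set0.
Proof. exact: sigma_algebra0. Qed.

Let rV_setC A : g_sigma_preimage coors A -> g_sigma_preimage coors (~` A).
Proof. exact: sigma_algebraC. Qed.

Let rV_bigcup (F : (set 'rV[R]_n)^nat) :
  (forall i, g_sigma_preimage coors (F i)) ->
  g_sigma_preimage coors (\bigcup_i (F i)).
Proof. exact: sigma_algebra_bigcup. Qed.

HB.instance Definition _ := @isMeasurable.Build default_measure_display
  'rV[R]_n (g_sigma_preimage coors) rV_set0 rV_setC rV_bigcup.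

End measurable_rV.

Definition cons_rV {R : realType} n (p : R * 'rV[R]_n) : 'rV[R]_n.+1 :=
  row_mx (p.1)%:M p.2.

Lemma cons_rV0 (R : realType) n (p : R * 'rV[R]_n) : cons_rV p 0 ord0 = p.1.
Proof.
rewrite /cons_rV (_ : ord0 = @lshift 1 n 0); last exact: val_inj.
by rewrite (@row_mxEl R 1 1 n) mxE eqxx mulr1n.
Qed.

Lemma cons_rVS (R : realType) n (p : R * 'rV[R]_n) (i : 'I_n) :
  cons_rV p 0 (lift ord0 i) = p.2 0 i.
Proof.
rewrite /cons_rV (_ : lift ord0 i = @rshift 1 n i); last exact: val_inj.
by rewrite (@row_mxEr R 1 1 n).
Qed.

Lemma measurable_coor (R : realType) n (i : 'I_n) :
  measurable_fun [set: 'rV[R]_n] (fun u => u 0 i).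
Proof.
move=> _ Y mY; rewrite setTI; apply: sub_sigma_algebra => /=.
rewrite -bigcup_seq/=; exists i => /=; first by rewrite mem_index_enum.
by exists Y => //; rewrite setTI.
Qed.

Lemma measurable_fun_rV (R : realType) n d (T : measurableType d)
    (f : T -> 'rV[R]_n) :
  (forall i, measurable_fun [set: T] (fun t => f t 0 i)) ->
  measurable_fun [set: T] f.
Proof.
move=> mf _ A mA; rewrite setTI.
pose C : set (set 'rV[R]_n) := [set B | measurable (f @^-1` B)].
suff : C A by [].
have sC : sigma_algebra setT C.
  split => /=.
  - by rewrite /C /= preimage_set0; exact: measurable0.
  - by move=> B; rewrite /C /= setTD preimage_setC => mB; exact: measurableC.
  - by move=> F mF; rewrite /C /= preimage_bigcup; exact: bigcupT_measurable.
apply: (smallest_sub sC) mA => B.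
rewrite -bigcup_seq/= => -[i _ [Y mY <-]].
by rewrite /C /= setTI -comp_preimage -[X in measurable X]setTI; exact: mf.
Qed.

Lemma measurable_cons_rV (R : realType) n :
  measurable_fun [set: R * 'rV[R]_n] (@cons_rV R n).
Proof.
apply: measurable_fun_rV => i; case: (unliftP ord0 i) => [j|] ->.
  rewrite (_ : (fun p => _) = (fun u : 'rV[R]_n => u 0 j) \o snd).
    exact: measurableT_comp (measurable_coor j) measurable_snd.
  by apply/funext => p; rewrite cons_rVS.
rewrite (_ : (fun p => _) = fst); first exact: measurable_fst.
by apply/funext => p; rewrite cons_rV0.
Qed.

Section lebesgue_step.
Context {R : realType} (n : nat).
Variable mu : {sigma_finite_measure set 'rV[R]_n -> \bar R}.

Definition lebesgue_step : set 'rV[R]_n.+1 -> \bar R :=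
  pushforward (@lebesgue_measure R \x mu)%E (@cons_rV R n).

HB.instance Definition _ := Measure.copy lebesgue_step
  (measure_function_pushforward__canonical__measure_function_Measure
     (@lebesgue_measure R \x mu)%E (@measurable_cons_rV R n)).

Let lebesgue_step_sigma_finite : sigma_finite setT lebesgue_step.
Proof.
have [F [FT mF]] : exists F : (set (measurableTypeR R * 'rV[R]_n))^nat,
    setT = \bigcup_k F k /\
    forall k, measurable (F k) /\ ((@lebesgue_measure R \x mu) (F k) < +oo)%E.
  have /sigma_finiteP[F [TF ndF Foo]] := sigma_finiteT (@lebesgue_measure R).
  have /sigma_finiteP[G [TG ndG Goo]] := sigma_finiteT mu.
  exists (fun n => F n `*` G n); split.
    rewrite -setXTT TF TG predeqE => -[x y]; split.
      move=> [/= [i _ Fix] [k _ Gky]]; exists (maxn i k) => //; split.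
      - by move: x Fix; exact/subsetPset/ndF/leq_maxl.
      - by move: y Gky; exact/subsetPset/ndG/leq_maxr.
    by move=> [i _ []/= ? ?]; split; exists i.
  move=> k; have [? ?] := Foo k; have [? ?] := Goo k.
  split; first exact: measurableX.
  by rewrite product_measure1E// lte_mul_pinfty// ge0_fin_numE.
pose dec (u : 'rV[R]_(1 + n)) : R * 'rV[R]_n := (u 0 (lshift n 0), rsubmx u).
have decK : cancel (@cons_rV R n) dec.
  by case=> a u; rewrite /dec /cons_rV row_mxEl row_mxKr mxE.
have mdec : measurable_fun setT dec.
  apply/measurable_fun_pairP; split; first exact: (@measurable_coor R n.+1).
  apply: measurable_fun_rV => i.
  rewrite (_ : (fun t => _) = (fun t : 'rV[R]_n.+1 => t 0 (rshift 1 i))).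
    exact: (@measurable_coor R n.+1).
  by apply/funext => t /=; rewrite mxE.
exists (fun k => dec @^-1` F k); first by rewrite -preimage_bigcup -FT preimage_setT.
move=> k; have [mFk Fk] := mF k; split.
  by rewrite -[X in measurable X]setTI; exact: mdec.
rewrite /lebesgue_step /pushforward -comp_preimage.
by rewrite (_ : dec \o _ = id)//; apply/funext.
Qed.

HB.instance Definition _ := Measure_isSigmaFinite.Build _ _ _ lebesgue_step
  lebesgue_step_sigma_finite.

End lebesgue_step.

(* Lebesgue measure on R^n (restricted to the Borel sets), as an iterated
   product of the one-dimensional Lebesgue measure. *)
Fixpoint lebesgue_rV (R : realType) (n : nat) :
    {sigma_finite_measure set 'rV[R]_n -> \bar R} :=
  match n with
  | 0 => \d_ (0 : 'rV[R]_0)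
  | n.+1 => lebesgue_step (lebesgue_rV R n)
  end.

Lemma lebesgue_rV_box (R : realType) n (A : 'I_n -> set R) :
  (forall i, measurable (A i)) ->
  lebesgue_rV R n [set u | forall i, A i (u 0 i)] =
    (\prod_(i < n) @lebesgue_measure R (A i))%E.
Proof.
elim: n A => [|n IH] A mA.
  rewrite big_ord0 /= /dirac indicE mem_set//=; by case.
rewrite big_ord_recl -(IH (fun i => A (lift ord0 i)))//.
have mB : measurable [set u : 'rV[R]_n | forall i, A (lift ord0 i) (u 0 i)].
  rewrite [X in measurable X](_ : _ = \bigcap_(i in [set: 'I_n])
      ((fun u : 'rV[R]_n => u 0 i) @^-1` A (lift ord0 i))).
    apply: fin_bigcap_measurable => // i _; rewrite -[X in measurable X]setTI.
    exact: measurable_coor.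
  by apply/seteqP; split => u /= uA i; [move=> _; exact: uA|exact: (uA i I)].
rewrite -product_measure1E//; last exact: mA.
apply: (congr1 (@lebesgue_measure R \x lebesgue_rV R n)%E).
apply/seteqP; split => -[a u] /=.
  move=> uA; split=> [|i]; first by have := uA ord0; rewrite cons_rV0.
  by have := uA (lift ord0 i); rewrite cons_rVS.
move=> [/= aA uA] i; case: (unliftP ord0 i) => [j|] ->.
  by rewrite cons_rVS; exact: uA.
by rewrite cons_rV0.
Qed.

Section Riesz.
Context {R : realType} {m : nat}.
Implicit Types (alpha kappa r : R) (delta : \bar R).
Implicit Types (x : 'rV[R]_m) (A Omega : set 'rV[R]_m).

(* Polar coordinates: the spherical Lebesgue measure of A `<=` S^(m-1) is
   m times the volume of the cone over A inside the unit ball. *)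
Definition sphere_measure A : \bar R :=
  (m%:R%:E * lebesgue_rV R m
     [set rho *: w | rho in `]0%R, 1%R] & w in A])%E.

(* [powR] gives 0 `^ s = 0 for s < 0, which only changes the integrand at one
   point. *)
Definition riesz_kernel alpha (u : 'rV[R]_m) : R :=
  enorm u `^ (alpha - m%:R).

(* Only meant for alpha <= 0. *)
Definition renorm_term alpha (eps : R) : R :=
  if alpha == 0 then fine (sphere_measure unit_sphere) * ln (1 / eps)
  else fine (sphere_measure unit_sphere) / (- alpha) * eps `^ alpha.

Definition riesz_potential alpha Omega x : R :=
  lim ((\int[lebesgue_rV R m]_(xi in Omega `\` cball eps x)
          riesz_kernel alpha (x - xi) - renorm_term alpha eps)
       @[eps --> 0^'+]).

Definition e_first : 'rV[R]_m := \row_(i < m) (i == 0 :> nat)%:R.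
Definition e_last : 'rV[R]_m := \row_(i < m) (i == m.-1 :> nat)%:R.

Definition cone_theta (theta : R) x kappa delta : set 'rV[R]_m :=
  open_cone x (cos theta *: e_first + sin theta *: e_last) kappa delta.

(* The infimum is a minimum: the integral depends continuously on theta, which
   ranges over a compact interval. *)
Definition cone_defect alpha kappa delta (D R0 r : R) : R :=
  inf [set \int[lebesgue_rV R m]_(xi in
               cone_theta theta (r *: e_first) kappa delta `&` cball D 0)
             riesz_kernel alpha xi
         - \int[lebesgue_rV R m]_(xi in cball D 0 `\` cball R0 0)
             riesz_kernel alpha xi
      | theta in `[0, (pi - kappa) / 2]].

(* The positive zero of [cone_defect]; it is unique for the parameters under
   consideration. *)
Definition Rtilde alpha kappa delta (D R0 : R) : R :=
  xget 0 [set r | 0 < r /\ cone_defect alpha kappa delta D R0 r = 0].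

End Riesz.

Arguments Rtilde {R} m alpha kappa delta D R0.

(* Main.v *)
Require Import Defs.
From mathcomp Require Import all_boot all_order all_algebra.
From mathcomp Require Import all_classical all_reals all_analysis.
From mathcomp Require Import measurable_realfun ring lra.
Import Order.TTheory GRing.Theory Num.Theory.
Import numFieldNormedType.Exports.
Set Implicit Arguments.
Unset Strict Implicit.
Unset Printing Implicit Defensive.
Local Open Scope classical_set_scope.
Local Open Scope ring_scope.

(** Write B_r for the closed ball of radius r centred at the origin, and call mass
    the measure with density |xi|^(alpha - m). The renormalization is such that
    the mass of B_R outside B_eps, minus the renormalization at eps, does not
    depend on eps ([shell_mass_renorm]). Hence the limit defining a potential is
    reached as soon as B_eps, moved to the point, is inside the body
    ([riesz_potentialE]), and a centred ball of radius R has potential -g(R), where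
    g(R) is the renormalization at R.

    A point x at distance at least R0 from the complement of X is the centre of a
    ball of radius R0 contained in X, so its potential is at least -g(R0). Let s be
    the distance from y to the complement of Y, D the diameter of Y, and put y at the
    origin. Then Y lies in B_D and avoids a cone with vertex on the sphere of radius
    s. So the potential of y is at most -g(D) minus the mass of the part of the
    cone in B_D, and it remains to see that this part outweighs the shell between
    R0 and D, whose mass is g(R0) - g(D).

    As the cone avoids the open ball of radius s, its axis is within
    (pi - kappa) / 2 of the outer normal ([cone_axis_angle]). A rotation, that is
    two reflections, brings it to one of the cones in the definition of the defect
    ([cone_mass_rotation]). If the defect vanishes at r >= s, such a cone at
    distance r has at least the mass of the shell, and it gains mass when its
    vertex moves inwards from distance r to s ([le_cone_mass]), because all its
    points get closer to the origin. The inequality is strict since Y, which contains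
    a ball of radius s around y, also stays away from the sphere of radius D: a part
    of B_D opposite to the cone is met by neither.

    Rotation invariance and homogeneity of the Lebesgue measure both follow
    from one application of Fubini ([lebesgue_rV_additive_map]); the mass of a
    shell follows from its derivative in the radius ([is_derive_shell_mass]). *)

(** * The Euclidean inner product and reflections *)

Section euclid.
Context {R : realType} {m : nat}.
Implicit Types (u v w x y : 'rV[R]_m).

Lemma dotC u v : dot u v = dot v u.
Proof. by apply: eq_bigr => i _; rewrite mulrC. Qed.

Lemma dotDl u v w : dot (u + v) w = dot u w + dot v w.
Proof. by rewrite -big_split; apply: eq_bigr => i _; rewrite mxE mulrDl. Qed.

Lemma dotZl a u v : dot (a *: u) v = a * dot u v.
Proof. by rewrite mulr_sumr; apply: eq_bigr => i _; rewrite mxE mulrA. Qed.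

Lemma dotDr u v w : dot u (v + w) = dot u v + dot u w.
Proof. by rewrite dotC dotDl dotC (dotC w). Qed.

Lemma dotZr a u v : dot u (a *: v) = a * dot u v.
Proof. by rewrite dotC dotZl dotC. Qed.

Lemma dotNl u v : dot (- u) v = - dot u v.
Proof. by rewrite -scaleN1r dotZl mulN1r. Qed.

Lemma dotNr u v : dot u (- v) = - dot u v.
Proof. by rewrite dotC dotNl dotC. Qed.

Definition dotE := (dotDl, dotDr, dotNl, dotNr, dotZl, dotZr).

Lemma dot_ge0 u : 0 <= dot u u.
Proof. by apply: sumr_ge0 => i _; rewrite -expr2 sqr_ge0. Qed.

Lemma sqr_coor_le_dot u i : u 0 i ^+ 2 <= dot u u.
Proof.
rewrite /dot (bigD1 i)//= -expr2 lerDl.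
by apply: sumr_ge0 => j _; rewrite -expr2 sqr_ge0.
Qed.

Lemma dot_eq0 u : dot u u = 0 -> u = 0.
Proof.
move=> u0; apply/rowP => i; rewrite mxE; apply/eqP.
by rewrite -sqrf_eq0 eq_le sqr_ge0 -u0 sqr_coor_le_dot.
Qed.

Lemma enorm_ge0 u : 0 <= enorm u. Proof. exact: sqrtr_ge0. Qed.

Lemma sqr_enorm u : enorm u ^+ 2 = dot u u.
Proof. by rewrite sqr_sqrtr ?dot_ge0. Qed.

Lemma enorm0 : enorm (0 : 'rV[R]_m) = 0.
Proof. by rewrite /enorm -(scale0r 0) dotZl mul0r sqrtr0. Qed.

Lemma enorm_eq0 u : (enorm u == 0) = (u == 0).
Proof.
apply/eqP/eqP => [u0|->]; last exact: enorm0.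
by apply: dot_eq0; rewrite -sqr_enorm u0 expr0n.
Qed.

Lemma enorm_gt0 u : (0 < enorm u) = (u != 0).
Proof. by rewrite lt_def enorm_eq0 enorm_ge0 andbT. Qed.

Lemma enormN u : enorm (- u) = enorm u.
Proof. by rewrite /enorm !dotE opprK. Qed.

Lemma enormB u v : enorm (u - v) = enorm (v - u).
Proof. by rewrite -enormN opprB. Qed.

Lemma enormZ a u : enorm (a *: u) = `|a| * enorm u.
Proof. by rewrite /enorm !dotE mulrA -expr2 sqrtrM ?sqr_ge0// sqrtr_sqr. Qed.

Lemma sqr_dot_le u v : dot u v ^+ 2 <= dot u u * dot v v.
Proof.
have [/dot_eq0 ->|v0] := eqVneq (dot v v) 0.
  by rewrite -(scale0r 0) !dotE !mul0r expr0n mulr0.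
have v_gt0 : 0 < dot v v by rewrite lt_def v0 dot_ge0.
have := dot_ge0 (dot v v *: u - dot u v *: v).
rewrite !dotE (dotC v u) => h.
rewrite -subr_ge0 -(pmulr_rge0 _ v_gt0).
by apply: le_trans h _; rewrite le_eqVlt; apply/orP; left; apply/eqP; ring.
Qed.

Lemma normr_dot_le u v : `|dot u v| <= enorm u * enorm v.
Proof.
rewrite -(@ler_pXn2r _ 2)// ?nnegrE ?mulr_ge0 ?enorm_ge0//.
by rewrite real_normK ?num_real// exprMn !sqr_enorm sqr_dot_le.
Qed.

Lemma dot_le u v : dot u v <= enorm u * enorm v.
Proof. exact: le_trans (ler_norm _) (normr_dot_le u v). Qed.

Lemma ler_enormD u v : enorm (u + v) <= enorm u + enorm v.
Proof.
rewrite -(@ler_pXn2r _ 2)// ?nnegrE ?addr_ge0 ?enorm_ge0//.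
rewrite sqrrD !sqr_enorm !dotE (dotC v u).
by have := dot_le u v; lra.
Qed.

Lemma coor_le_enorm u i : `|u 0 i| <= enorm u.
Proof.
rewrite -(@ler_pXn2r _ 2)// ?nnegrE ?enorm_ge0//.
by rewrite real_normK ?num_real// sqr_enorm sqr_coor_le_dot.
Qed.

Lemma unit_sphere_dot w : unit_sphere w -> dot w w = 1.
Proof. by rewrite -sqr_enorm /unit_sphere /= => ->; rewrite expr1n. Qed.

Lemma dot_unit_sphere w : dot w w = 1 -> unit_sphere w.
Proof. by rewrite /unit_sphere /= /enorm => ->; rewrite sqrtr1. Qed.

(** For w = 0 the coefficient is a division by zero, hence 0, and the reflection
    is the identity; the lemmas below hold for every w. *)
Definition reflection w x := x - (2 * dot x w / dot w w) *: w.

Lemma reflectionD w x y : reflection w (x + y) = reflection w x + reflection w y.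
Proof.
rewrite /reflection dotDl mulrDr mulrDl scalerDl opprD.
by rewrite addrACA.
Qed.

Lemma reflectionZ w a x : reflection w (a *: x) = a *: reflection w x.
Proof.
rewrite /reflection dotZl scalerBr scalerA.
by congr (_ - _ *: _); ring.
Qed.

Lemma dot_reflection w x y : dot (reflection w x) (reflection w y) = dot x y.
Proof.
rewrite /reflection; have [w0|w0] := eqVneq (dot w w) 0.
  by rewrite (dot_eq0 w0) !scaler0 !subr0.
by rewrite !dotE (dotC w y); field.
Qed.

Lemma enorm_reflection w x : enorm (reflection w x) = enorm x.
Proof. by rewrite /enorm dot_reflection. Qed.

Lemma reflectionK w : involutive (reflection w).
Proof.
move=> x; rewrite /reflection; have [w0|w0] := eqVneq (dot w w) 0.
  by rewrite (dot_eq0 w0) !scaler0 !subr0.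
rewrite !dotE -addrA -opprD -scalerDl.
rewrite (_ : 2 * _ / _ + _ = 0) ?scale0r ?subr0//; by field.
Qed.

(** The mirror of a - b is the bisecting hyperplane of a and b. Two such
    reflections carry any pair of unit vectors to any other pair with the same
    inner product, so reflections are all the rotations needed here. *)
Lemma reflection_swap a b : dot a a = dot b b -> reflection (a - b) a = b.
Proof.
move=> ab; rewrite /reflection.
have [w0|w0] := eqVneq (dot (a - b) (a - b)) 0.
  by have/eqP := dot_eq0 w0; rewrite subr_eq0 => /eqP ->; rewrite subrr scaler0 subr0.
rewrite (_ : _ / _ = 1) ?scale1r ?opprB ?subrKC//.
move: w0; rewrite !dotE (dotC b a) -ab => w0.
by apply: (canLR (mulfK _)) => //; rewrite mul1r; ring.
Qed.

Lemma reflection_fix w x : dot x w = 0 -> reflection w x = x.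
Proof. by move=> xw; rewrite /reflection xw mulr0 mul0r scale0r subr0. Qed.

End euclid.

(** * Euclidean balls, bodies and distances *)

Section topology.
Context {R : realType} {m : nat}.
Implicit Types (u v w x y : 'rV[R]_m) (A : set 'rV[R]_m).

Lemma enorm_ball x y e : enorm (y - x) < e -> ball x e y.
Proof.
move=> xye; rewrite -ball_normE/= distrC. 
have e0 : 0 < e by exact: le_lt_trans (enorm_ge0 _) xye.
rewrite /Num.Def.normr/= mx_normrE.
apply/bigmax_ltP; split=> // -[i j] _ /=.
by apply: le_lt_trans xye; rewrite ord1 coor_le_enorm.
Qed.

(** The topology is that of the sup norm; continuity of the Euclidean norm, and
    the inclusion of Euclidean balls in sup norm balls, make both interchangeable. *)
Lemma continuous_dot (f g : 'rV[R]_m -> 'rV[R]_m) :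
  continuous f -> continuous g -> continuous (fun x => dot (f x) (g x)).
Proof.
move=> cf cg; apply: continuous_big => [|i _ x]; first exact: add_continuous.
apply: cvgM; first exact: nbhs_filter.
- exact: (cvg_comp _ _ (cf x) (@coord_continuous _ _ _ 0 i (f x))).
- exact: (cvg_comp _ _ (cg x) (@coord_continuous _ _ _ 0 i (g x))).
Qed.

Lemma continuous_enormB x : continuous (fun y => enorm (y - x)).
Proof.
move=> y.
apply: (@continuous_comp _ _ _ (fun y => dot (y - x) (y - x)) Num.sqrt); last first.
  exact: sqrt_continuous.
have cB : continuous (fun y : 'rV[R]_m => y - x).
  by move=> z; apply: continuousB; [exact: id|exact: cst_continuous].
exact: continuous_dot.
Qed.

Lemma interior_enorm A y : A° y ->
  exists2 e, 0 < e & forall x, enorm (x - y) < e -> A x.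
Proof.
move=> /nbhs_ballP[e /= e0 yA]; exists e => // x xy; apply: yA.
exact: enorm_ball.
Qed.

Lemma open_enorm A y : open A -> A y ->
  exists2 e, 0 < e & forall x, enorm (x - y) < e -> A x.
Proof. by move=> oA Ay; apply: interior_enorm; exact: open_nbhs_nbhs. Qed.

Lemma closed_cball rho x : closed (cball rho x).
Proof.
apply: (@preimage_closed _ _ (fun y => enorm (y - x)) [set t | t <= rho]).
  by move=> y _; exact: continuous_enormB.
exact: closed_le.
Qed.

Lemma closed_cball_exterior rho x : closed [set y | rho <= enorm (y - x)].
Proof.
apply: (@preimage_closed _ _ (fun y => enorm (y - x)) [set t | rho <= t]).
  by move=> y _; exact: continuous_enormB.
exact: closed_ge.
Qed.

Lemma open_enorm_ball x e : open [set y | enorm (y - x) < e].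
Proof.
apply: (@open_comp _ _ (fun y => enorm (y - x)) [set t | t < e]).
  by move=> y _; exact: continuous_enormB.
exact: open_lt.
Qed.

Lemma open_enorm_exterior x e : open [set y | e < enorm (y - x)].
Proof.
apply: (@open_comp _ _ (fun y => enorm (y - x)) [set t | e < t]).
  by move=> y _; exact: continuous_enormB.
exact: open_gt.
Qed.

Lemma bounded_enorm A : bounded_set A ->
  exists M, forall x, A x -> enorm x <= M.
Proof.
move=> [M [_ /(_ (M + 1))]]; rewrite ltrDl ltr01 => /(_ isT) AM.
have coorM x i : A x -> `|x 0 i| <= M + 1.
  move=> /AM; apply: le_trans; rewrite /Num.Def.normr/= mx_normrE.
  exact: (le_bigmax _ (fun ij => `|x ij.1 ij.2|) (0, i)).
exists (Num.sqrt (m%:R * (M + 1) ^+ 2)) => x Ax; apply: ler_wsqrtr.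
rewrite /dot mulr_natl -[X in _ <= _ *+ X](card_ord m) -sumr_const.
apply: ler_sum => i _.
rewrite -expr2 -real_normK ?num_real// lerXn2r ?nnegrE//.
  exact: le_trans (coorM _ i Ax).
exact: coorM.
Qed.

Lemma body_closed A : body A -> closed A.
Proof. by move=> [U [_ _ ->]]; exact: closed_closure. Qed.

Lemma body_bounded A : body A -> exists M, forall x, A x -> enorm x <= M.
Proof.
move=> [U [_ /bounded_enorm[M UM] ->]]; exists M => x.
suff : closure U `<=` cball M 0 by move=> /[apply]; rewrite /cball/= subr0.
rewrite (closure_id (cball M 0)).1; last exact: closed_cball.
by apply: closureS => y /UM; rewrite /cball/= subr0.
Qed.

Lemma dist_set_lbound x A : has_lbound [set enorm (x - a) | a in A].
Proof. by exists 0 => _ [a _ <-]; exact: enorm_ge0. Qed.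

Lemma dist_set_le x A a : A a -> dist_set x A <= enorm (x - a).
Proof. by move=> Aa; apply: ge_inf; [exact: dist_set_lbound|exists a]. Qed.

(** An open set comes closer to x than any of its points: move from a towards x. *)
Lemma dist_set_lt x A a : open A -> A a -> a != x -> dist_set x A < enorm (x - a).
Proof.
move=> oA Aa ax; have [e e0 aeA] := open_enorm oA Aa.
have n0 : 0 < enorm (x - a) by rewrite enorm_gt0 subr_eq0 eq_sym.
pose t := Num.min 1 (e / (2 * enorm (x - a))).
have t0 : 0 < t by rewrite lt_min ltr01 divr_gt0// mulr_gt0.
have t1 : t <= 1 by rewrite ge_min lexx.
have te : t * enorm (x - a) < e.
  have : t <= e / (2 * enorm (x - a)) by rewrite ge_min lexx orbT.
  rewrite ler_pdivlMr ?mulr_gt0// => h.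
  have : 0 < t * enorm (x - a) by exact: mulr_gt0.
  lra.
have /dist_set_le : A (a + t *: (x - a)).
  by apply: aeA; rewrite addrC addKr enormZ gtr0_norm.
move=> /(_ x)/le_lt_trans; apply.
rewrite (_ : x - _ = (1 - t) *: (x - a)).
  rewrite enormZ ger0_norm ?subr_ge0// gtr_pMl//; lra.
by rewrite scalerBl scale1r opprD addrA.
Qed.

End topology.

(** * Translations of Lebesgue measure *)

Section lebesgue_translation.
Context {R : realType}.

Lemma lebesgue_measure_translation (a : R) (A : set R) : measurable A ->
  lebesgue_measure ((fun t => t + a) @^-1` A) = lebesgue_measure A.
Proof.
move=> mA.
have mf : measurable_fun [set: measurableTypeR R] ((fun t => t + a) : _ -> measurableTypeR R).
  exact: measurable_funD.
pose nu := measure_function_pushforward__canonical__measure_function_Measure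
  (@lebesgue_measure R) mf.
rewrite -[LHS]/(nu A); apply/esym; apply: lebesgue_measure_unique => //.
move=> X /ocitvP[->|[[c d] /= cd ->]]; first by rewrite !measure0.
rewrite /= /pushforward.
rewrite (_ : _ @^-1` _ = `]c - a, d - a]%classic); last first.
  by apply/seteqP; split => t /=; rewrite !in_itv/= ltrBlDr lerBrDr.
rewrite !lebesgue_measure_itv /= !lte_fin ltrD2r cd.
by rewrite -!EFinB; congr EFin; ring.
Qed.

End lebesgue_translation.

Section measurable_rV.
Context {R : realType} {n : nat}.
Implicit Types (A B : set 'rV[R]_n).

Lemma measurable_box (B : 'I_n -> set R) : (forall i, measurable (B i)) ->
  measurable [set u : 'rV[R]_n | forall i, B i (u 0 i)].
Proof.
move=> mB; rewrite [X in measurable X](_ : _ = \bigcap_(i in [set: 'I_n])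
    ((fun u : 'rV[R]_n => u 0 i) @^-1` B i)).
  apply: fin_bigcap_measurable => // i _; rewrite -[X in measurable X]setTI.
  exact: measurable_coor.
by apply/seteqP; split => u /= uA i; [move=> _; exact: uA|exact: (uA i I)].
Qed.

(** An open set is the union of the open cubes with rational centre and radius
    1 / (k + 1) that it contains, and there are countably many of them. *)
Lemma open_measurable_rV A : open A -> measurable A.
Proof.
move=> oA.
pose box (p : 'rV[rat]_n * nat) : set 'rV[R]_n :=
  [set u | forall i,
    u 0 i \in `]ratr (p.1 0 i) - p.2.+1%:R^-1, ratr (p.1 0 i) + p.2.+1%:R^-1[].
have mbox p : measurable (box p).
  by apply: (@measurable_box (fun i =>
    [set` `]ratr (p.1 0 i) - p.2.+1%:R^-1, ratr (p.1 0 i) + p.2.+1%:R^-1[])) => i.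
rewrite (_ : A = \bigcup_(p in [set p | box p `<=` A]) box p); last first.
  apply/seteqP; split => [x Ax|x [p /= pA px]]; last exact: pA.
  have /nbhs_ballP[e /= e0 xA] : nbhs x A by exact: open_nbhs_nbhs.
  pose k := Num.truncn (2 / e).
  have ke : k.+1%:R^-1 < e / 2 :> R.
    by rewrite -[ltRHS]invf_div ltf_pV2 ?posrE ?divr_gt0// truncnS_gt.
  have k0 : 0 < k.+1%:R^-1 :> R by rewrite invr_gt0.
  set d : R := k.+1%:R^-1 in ke k0.
  have h i : exists q : rat, ratr q \in `]x 0 i - d, x 0 i + d[.
    by apply: rat_in_itvoo; rewrite ltrD2l gtrN.
  have [q xq] := choice h.
  exists (\row_i q i, k) => /= [u|] /=.
    move=> uq; apply: xA; split=> // i j; rewrite ord1 /ball/=.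
    move: (uq j) (xq j); rewrite -/d; rewrite !in_itv/= mxE => /andP[? ?] /andP[? ?].
    by rewrite -/d ltr_norml; apply/andP; split; lra.
  move=> i; move: (xq i); rewrite -/d !in_itv/= mxE => /andP[? ?].
  by apply/andP; split; lra.
rewrite bigcup_mkcond; apply: countable_bigcupT_measurable => [|p]; first exact: countableP.
by case: ifP => _; [exact: mbox|exact: measurable0].
Qed.

Lemma closed_measurable_rV A : closed A -> measurable A.
Proof.
move=> cA; rewrite -(setCK A); apply: measurableC.
by apply: open_measurable_rV; rewrite openC.
Qed.

End measurable_rV.

Section translation.
Context {R : realType}.

Lemma measurable_translation n (a : 'rV[R]_n) : measurable_fun setT (fun u : 'rV[R]_n => u + a).
Proof.
apply: measurable_fun_rV => i.
rewrite (_ : (fun _ => _) = (fun u : 'rV[R]_n => u 0 i + a 0 i)).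
  apply: measurable_funD => //; exact: measurable_coor.
by apply/funext => u; rewrite mxE.
Qed.

Lemma measurable_preimage d d' (T : measurableType d) (T' : measurableType d')
    (f : T -> T') (A : set T') :
  measurable_fun setT f -> measurable A -> measurable (f @^-1` A).
Proof. by move=> mf mA; rewrite -[X in measurable X]setTI; exact: mf. Qed.

Lemma cons_rV_add n (p : R * 'rV[R]_n) (u : 'rV[R]_n.+1) :
  cons_rV p + u = cons_rV (p.1 + u 0 ord0, p.2 + \row_i u 0 (lift ord0 i)).
Proof.
apply/rowP => i; rewrite mxE; case: (unliftP ord0 i) => [j|] ->.
  by rewrite !cons_rVS !mxE.
by rewrite !cons_rV0.
Qed.

(** Induction on the dimension: the sections of a translated set are translated
    sections, and the integral over the first coordinate is translation invariant. *)
Lemma lebesgue_rV_translation n (a : 'rV[R]_n) A : measurable A ->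
  lebesgue_rV R n ((fun u => u + a) @^-1` A) = lebesgue_rV R n A.
Proof.
elim: n a A => [|n IH] a A mA.
  congr (lebesgue_rV R 0 _); apply/seteqP; split => u /=.
    by rewrite (_ : u + a = u)//; apply/rowP; case.
  by rewrite (_ : u + a = u)//; apply/rowP; case.
pose S := @cons_rV R n @^-1` A.
have mS : measurable S by exact: measurable_preimage (@measurable_cons_rV R n) mA.
pose a' : 'rV[R]_n := \row_i a 0 (lift ord0 i).
pose f (t : measurableTypeR R) := lebesgue_rV R n (xsection S t).
have mf : measurable_fun setT f by exact: measurable_fun_xsection.
pose g (t : measurableTypeR R) : measurableTypeR R := (t : R) + a 0 ord0.
have mg : measurable_fun setT g.
  exact: measurable_funD.
transitivity (\int[@lebesgue_measure R]_t f (g t))%E.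
  apply: eq_integral => t _ /=; rewrite /f -(IH a'); last exact: measurable_xsection.
  congr (lebesgue_rV R n _); apply/seteqP.
  by split => w; rewrite /xsection/= !inE/= /S/= cons_rV_add.
transitivity (\int[measure_function_pushforward__canonical__measure_function_Measure
  (@lebesgue_measure R) mg]_t f t)%E.
  by rewrite ge0_integral_pushforward.
apply: eq_measure_integral => B mB _.
exact: lebesgue_measure_translation.
Qed.

End translation.

Section haar.
Context {R : realType} {n : nat}.
Let mu := lebesgue_rV R n.
Implicit Types (A B : set 'rV[R]_n).

Lemma lebesgue_rV_fubini (S : set ('rV[R]_n * 'rV[R]_n)) : measurable S ->
  (\int[mu]_x mu (xsection S x) = \int[mu]_y mu (ysection S y))%E.
Proof.
move=> mS; have := indic_fubini_tonelli mu mu mS.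
by rewrite indic_fubini_tonelli_FE// indic_fubini_tonelli_GE.
Qed.

(** The uniqueness of Haar measure, for the pair mu and B -> mu (T^-1 B), in the
    form of a proportion: Fubini computes in two ways the measure of the pairs
    (x, y) with x in A and x + T y in B. The identity determines the factor by
    which T changes volumes as soon as it is known on one symmetric set A: a cube
    for homotheties, the unit ball for isometries. *)
Lemma lebesgue_rV_additive_map (T : 'rV[R]_n -> 'rV[R]_n) A B :
  {morph T : x y / x + y} -> (forall x, exists y, T y = x) -> measurable_fun setT T ->
  measurable A -> measurable B -> (forall x, A (- x) = A x) ->
  (mu A * mu (T @^-1` B) = mu B * mu (T @^-1` A))%E.
Proof.
move=> TD Tsurj mT mA mB symA.
have mS : measurable_fun [set: 'rV[R]_n * 'rV[R]_n] (fun p => T p.2).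
  exact: measurableT_comp mT measurable_snd.
have mD (s : R) : measurable_fun [set: 'rV[R]_n * 'rV[R]_n] (fun p => p.1 + s *: T p.2).
  apply: measurable_fun_rV => i.
  rewrite (_ : (fun _ => _) = (fun p : 'rV[R]_n * 'rV[R]_n => p.1 0 i + s * T p.2 0 i)).
    apply: measurable_funD.
      exact: measurableT_comp (measurable_coor i) measurable_fst.
    apply: measurable_funM; first exact: measurable_cst.
    exact: measurableT_comp (measurable_coor i) mS.
  by apply/funext => p; rewrite !mxE.
(* Both sides compute the measure of S A B 1, which the shear
   (x, y) -> (x + T y, y) maps to S B A (-1). *)
pose S (C D : set 'rV[R]_n) (s : R) : set ('rV[R]_n * 'rV[R]_n) :=
  [set p | C p.1 /\ D (p.1 + s *: T p.2)].
have mSet (C D : set 'rV[R]_n) (s : R) :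
    measurable C -> measurable D -> measurable (S C D s).
  move=> mC mE.
  rewrite (_ : S C D s = fst @^-1` C `&` (fun p => p.1 + s *: T p.2) @^-1` D)//.
  by apply: measurableI; apply: measurable_preimage.
have intE (C D : set 'rV[R]_n) (s : R) : measurable C -> measurable D ->
    (forall x : 'rV[R]_n, C x -> mu [set y | D (x + s *: T y)] = mu (T @^-1` D)) ->
    (\int[mu]_x mu (xsection (S C D s) x) = mu C * mu (T @^-1` D))%E.
  move=> mC mE CD; rewrite (eq_integral (fun x => (\1_C x)%:E * mu (T @^-1` D))%E).
    rewrite ge0_integralZr ?integral_indic ?setIT//.
    by apply/measurable_EFinP; exact: measurable_indic.
  move=> x _; rewrite indicE; case: (boolP (x \in C)) => [|xC].
    rewrite inE mul1e => Cx; rewrite -(CD x Cx); congr (mu _).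
    by apply/seteqP; split => y; rewrite /xsection/= inE /S/= => // -[].
  rewrite mul0e (_ : xsection _ _ = set0) ?measure0//.
  apply/seteqP; split => y //; rewrite /xsection/= inE /S/= => -[Cx _].
  by move/negP: xC; apply; exact: mem_set.
transitivity (\int[mu]_x mu (xsection (S A B 1%R) x))%E.
  rewrite intE// => x Ax; have [x' <-] := Tsurj x.
  rewrite -[RHS](lebesgue_rV_translation x'); last exact: measurable_preimage.
  by congr (mu _); apply/seteqP; split => y /=; rewrite scale1r -TD addrC.
transitivity (\int[mu]_x mu (xsection (S B A (-1)%R) x))%E; last first.
  rewrite intE// => x Bx; have [x' Tx'] := Tsurj (- x).
  rewrite -[RHS](lebesgue_rV_translation x'); last exact: measurable_preimage.
  congr (mu _); apply/seteqP.
  by split => y /=; rewrite -symA TD Tx' opprD scaleN1r opprK addrC.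
rewrite !lebesgue_rV_fubini; [|exact: mSet|exact: mSet].
apply: eq_integral => y _.
rewrite -[RHS](lebesgue_rV_translation (T y)); last first.
  exact: measurable_ysection (mSet _ _ _ mB mA).
congr (mu _); apply/seteqP.
by split => x /=; rewrite /ysection/= !inE /S/= scale1r scaleN1r addrK => -[].
Qed.

End haar.

(** * Linear maps and Lebesgue measure *)

Section lebesgue_euclid.
Context {R : realType} {n : nat}.
Let mu := lebesgue_rV R n.
Implicit Types (A B : set 'rV[R]_n) (x y : 'rV[R]_n).

Definition cube x (e : R) : set 'rV[R]_n :=
  [set u | forall i, u 0 i \in `[x 0 i - e, x 0 i + e]].

Lemma measurable_cube x e : measurable (cube x e).
Proof.
exact: (@measurable_box _ _ (fun i => [set` `[x 0 i - e, x 0 i + e]])).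
Qed.

Lemma lebesgue_rV_cube x e : 0 <= e -> mu (cube x e) = ((2 * e) ^+ n)%:E.
Proof.
move=> e0.
rewrite [LHS](@lebesgue_rV_box _ _ (fun i => [set` `[x 0 i - e, x 0 i + e]]))//.
rewrite (eq_bigr (fun=> (2 * e)%:E)) => [|i _].
  by rewrite prodEFin prodr_const card_ord.
rewrite lebesgue_measure_itv /= lte_fin; case: ifPn => h.
  by rewrite -EFinB; congr EFin; ring.
by congr EFin; lra.
Qed.

Lemma measurable_dotl x : measurable_fun setT (fun y : 'rV[R]_n => dot y x).
Proof.
apply: measurable_sum => i; apply: measurable_funM; last exact: measurable_cst.
exact: measurable_coor.
Qed.

Lemma measurable_enorm : measurable_fun setT (@enorm R n).
Proof.
rewrite (_ : @enorm R n = fun u => dot u u `^ 2^-1).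
  apply: (@measurableT_comp _ _ _ _ _ _ (fun t : R => t `^ 2^-1)).
    exact: measurable_powR.
  apply: measurable_sum => i; apply: measurable_funM; exact: measurable_coor.
by apply/funext => u; rewrite powR12_sqrt ?dot_ge0.
Qed.

Lemma measurable_cball r x : measurable (cball r x).
Proof. apply: closed_measurable_rV; exact: closed_cball. Qed.

Lemma cball_scale r t : 0 < t ->
  (fun u => t *: u) @^-1` cball r 0 = cball (t^-1 * r) (0 : 'rV[R]_n).
Proof.
move=> t0; apply/seteqP; split => u; rewrite /cball/= !subr0 enormZ gtr0_norm//.
  by move=> h; rewrite ler_pdivlMl.
by rewrite ler_pdivlMl.
Qed.

(** The proportion of [lebesgue_rV_additive_map] for the cube of side 2. *)
Lemma lebesgue_rV_scale t A : 0 < t -> measurable A ->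
  mu ((fun u => t *: u) @^-1` A) = ((t^-1 ^+ n)%:E * mu A)%E.
Proof.
move=> t0 mA.
have mT : measurable_fun setT (fun u : 'rV[R]_n => t *: u).
  apply: measurable_fun_rV => i.
  rewrite (_ : (fun _ => _) = (fun u : 'rV[R]_n => t * u 0 i)).
    by apply: measurable_funM; [exact: measurable_cst|exact: measurable_coor].
  by apply/funext => u; rewrite mxE.
have := @lebesgue_rV_additive_map R n _ (cube 0 1) A
  (fun x y => scalerDr t x y) _ mT (measurable_cube _ _) mA.
have -> : (fun u => t *: u) @^-1` cube 0 1 = cube 0 t^-1.
  apply/seteqP; split => u /= h i; move: (h i);
    rewrite !mxE !in_itv/= !sub0r !add0r -!ler_norml normrM gtr0_norm//.
    by rewrite -ler_pdivlMl// mulr1.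
  by rewrite -ler_pdivlMl// mulr1.
rewrite -/mu !lebesgue_rV_cube ?ler01 ?invr_ge0 1?ltW// mulr1 exprMn EFinM => h.
have {h} : ((2 ^+ n)%:E * mu ((fun u => t *: u) @^-1` A) =
    (2 ^+ n)%:E * ((t^-1 ^+ n)%:E * mu A))%E.
  rewrite h; first by rewrite muleC muleA.
    by move=> x; exists (t^-1 *: x); rewrite scalerA divff ?gt_eqF// scale1r.
  move=> x; apply/propext; split => h' i; move: (h' i);
    by rewrite !mxE !in_itv/= !sub0r !add0r -!ler_norml normrN.
move/(congr1 (fun z => ((2 ^+ n)^-1)%:E * z)%E).
by rewrite !muleA -!EFinM mulVf ?mul1e ?mul1r// expf_neq0.
Qed.

Lemma open_lebesgue_rV_gt0 A : open A -> A !=set0 -> (0 < mu A)%E.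
Proof.
move=> oA [x Ax].
have /nbhs_ballP[e /= e0 xA] : nbhs x A by exact: open_nbhs_nbhs.
have e2 : 0 < e / 2 by rewrite divr_gt0.
apply: (@lt_le_trans _ _ (mu (cube x (e / 2)))).
  by rewrite lebesgue_rV_cube ?ltW// lte_fin exprn_gt0// mulr_gt0.
apply: le_measure; rewrite ?inE.
- exact: measurable_cube.
- exact: open_measurable_rV.
move=> u xu; apply: xA; split => // i j; rewrite ord1 /ball/=.
move: (xu j); rewrite in_itv/= => /andP[? ?].
by rewrite ltr_norml; apply/andP; split; lra.
Qed.

Lemma cball_lebesgue_rV_lty r x : (mu (cball r x) < +oo)%E.
Proof.
apply: (@le_lt_trans _ _ (mu (cube x (Num.max r 0)))).
  apply: le_measure; rewrite ?inE; [exact: measurable_cball|exact: measurable_cube|].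
  move=> u xu i; rewrite in_itv/= -ler_distl.
  apply: (@le_trans _ _ r); last by rewrite le_max lexx.
  by apply: le_trans xu; have := coor_le_enorm (u - x) i; rewrite !mxE.
by rewrite lebesgue_rV_cube ?ltry// le_max lexx orbT.
Qed.

Lemma measurable_reflection w : measurable_fun setT (@reflection R n w).
Proof.
apply: measurable_fun_rV => i.
rewrite (_ : (fun _ => _) = (fun u : 'rV[R]_n => u 0 i - 2 * dot u w / dot w w * w 0 i)).
  apply: measurable_funB; first exact: measurable_coor.
  apply: measurable_funM; last exact: measurable_cst.
  apply: measurable_funM; last exact: measurable_cst.
  by apply: measurable_funM; [exact: measurable_cst|exact: measurable_dotl].
by apply/funext => u; rewrite !mxE.
Qed.

(** The proportion of [lebesgue_rV_additive_map] for the unit ball, which the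
    reflection preserves and whose volume is positive and finite. *)
Lemma reflection_lebesgue_rV w A : measurable A ->
  mu (reflection w @^-1` A) = mu A.
Proof.
move=> mA.
have mT := measurable_reflection w.
have := @lebesgue_rV_additive_map R n _ (cball 1 0) A (reflectionD w) _ mT
   (measurable_cball _ _) mA.
have -> : reflection w @^-1` cball 1 0 = cball 1 0.
  by apply/seteqP; split => u; rewrite /cball/= !subr0 enorm_reflection.
rewrite -/mu => h.
have fin1 : mu (cball 1 0) \is a fin_num by rewrite ge0_fin_numE// cball_lebesgue_rV_lty.
have gt1 : (0 < mu (cball 1 0))%E.
  apply: (@lt_le_trans _ _ (mu [set u | enorm (u - 0) < 1])).
    apply: open_lebesgue_rV_gt0; last by exists 0; rewrite /= subr0 enorm0.
    exact: open_enorm_ball.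
  apply: le_measure; rewrite ?inE; [|exact: measurable_cball|by move=> u /ltW].
  by apply: open_measurable_rV; exact: open_enorm_ball.
have {h} : (mu (cball 1 0) * mu (reflection w @^-1` A) = mu (cball 1 0) * mu A)%E.
  rewrite h; first exact: muleC.
    by move=> x; exists (reflection w x); rewrite reflectionK.
  by move=> x; rewrite /cball/= !subr0 enormN.
move: fin1 gt1; case: (mu (cball 1 0)) => // c _; rewrite lte_fin => c0.
move/(congr1 (fun z => c^-1%:E * z)%E).
by rewrite !muleA -!EFinM mulVf ?mul1e// gt_eqF.
Qed.

Lemma lebesgue_rV_cball r : 0 < r -> mu (cball r 0) = ((r ^+ n)%:E * mu (cball 1 0))%E.
Proof.
move=> r0; rewrite -[in RHS](invrK r) -lebesgue_rV_scale ?invr_gt0//; last first.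
  exact: measurable_cball.
by rewrite cball_scale ?invr_gt0// invrK mulr1.
Qed.

(** The cone over the sphere in the definition is the unit ball without its centre,
    a point of measure 0 in positive dimension. *)
Lemma sphere_measureE : (0 < n)%N ->
  sphere_measure (@unit_sphere R n) = (n%:R%:E * mu (cball 1 0))%E.
Proof.
move=> n0; rewrite /sphere_measure; congr (_ * _)%E.
have mu0 : mu [set 0] = 0%E.
  rewrite (_ : [set 0] = cube 0 0).
    by rewrite lebesgue_rV_cube// mulr0 expr0n eqn0Ngt n0.
  apply/seteqP; split => u /=; first by move=> -> i; rewrite mxE in_itv/= subr0 addr0 lexx.
  move=> h; apply/rowP => i; move: (h i); rewrite mxE in_itv/= subr0 addr0.
  by move=> ?; apply/eqP; rewrite eq_le andbC.
have m0 : measurable [set (0 : 'rV[R]_n)].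
  apply: closed_measurable_rV.
  rewrite (_ : [set 0] = cball 0 0); first exact: closed_cball.
  apply/seteqP; split => u; rewrite /cball/= subr0; first by move=> ->; rewrite enorm0.
  by move=> u0; apply/eqP; rewrite -enorm_eq0 eq_le u0 enorm_ge0.
rewrite -/mu (_ : [set _ *: _ | _ in _ & _ in _] = cball 1 0 `\` [set 0]).
  rewrite -[in RHS](@setDUK _ [set 0] (cball 1 0)); last first.
    by move=> _ ->; rewrite /cball/= subr0 enorm0.
  rewrite measureU//; last 2 first.
  - by apply: measurableD => //; exact: measurable_cball.
  - by rewrite setDIK.
  by rewrite [X in (X + _)%E](mu0 : _ = _) add0e.
apply/seteqP; split => [_ [rho /= + [w w1 <-]]|u [u1 u0]].
  rewrite in_itv/= => /andP[rho0 rho1]; rewrite /cball/= subr0 enormZ w1 mulr1 gtr0_norm//.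
  split=> // /eqP; rewrite scaler_eq0 gt_eqF//= -enorm_eq0 w1.
  by rewrite oner_eq0.
have nu0 : 0 < enorm u by rewrite enorm_gt0; exact/eqP.
exists (enorm u) => /=; first by rewrite in_itv/= nu0; move: u1; rewrite /cball/= subr0.
exists ((enorm u)^-1 *: u).
  by rewrite /unit_sphere/= enormZ gtr0_norm ?invr_gt0// mulVf ?gt_eqF.
by rewrite scalerA divff ?gt_eqF// scale1r.
Qed.

End lebesgue_euclid.

(** * The measure whose density is the Riesz kernel *)

Lemma nonpos_ler_powR (R : realType) (p a b : R) : p <= 0 -> 0 < a -> a <= b ->
  b `^ p <= a `^ p.
Proof.
move=> p0 a0 ab; rewrite -(opprK p) !(powRN _ (- p)) lef_pV2 ?posrE ?powR_gt0//.
  by rewrite ge0_ler_powR ?nnegrE ?oppr_ge0// ?ltW// (lt_le_trans a0).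
exact: lt_le_trans ab.
Qed.

Section riesz_mass.
Context {R : realType} {n : nat}.
Context (alpha : R).
Let mu := lebesgue_rV R n.
Implicit Types (A B : set 'rV[R]_n) (x y : 'rV[R]_n).
Local Notation K := (@riesz_kernel R n alpha).

Definition riesz_mass A : \bar R := (\int[mu]_(xi in A) (K xi)%:E)%E.

Lemma measurable_riesz_kernel D : measurable_fun D (fun x => (K x)%:E).
Proof.
apply/measurable_EFinP; apply: measurable_funTS.
apply: (@measurableT_comp _ _ _ _ _ _ (fun t : R => t `^ (alpha - n%:R))).
  exact: measurable_powR.
exact: measurable_enorm.
Qed.
Hint Resolve measurable_riesz_kernel : core.

Lemma riesz_kernel_ge0 x : (0 <= (K x)%:E)%E.
Proof. by rewrite lee_fin powR_ge0. Qed.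
Hint Resolve riesz_kernel_ge0 : core.

Lemma riesz_mass_ge0 A : (0 <= riesz_mass A)%E.
Proof. exact: integral_ge0. Qed.

Lemma le_riesz_mass A B : measurable A -> measurable B -> A `<=` B ->
  (riesz_mass A <= riesz_mass B)%E.
Proof. by move=> mA mB AB; apply: ge0_subset_integral. Qed.

Lemma riesz_massU A B : measurable A -> measurable B -> A `&` B = set0 ->
  riesz_mass (A `|` B) = (riesz_mass A + riesz_mass B)%E.
Proof. by move=> mA mB AB; apply: ge0_integral_setU => //; exact/disj_set2P. Qed.

Lemma integral_measure_preserving (T : 'rV[R]_n -> 'rV[R]_n) (f : 'rV[R]_n -> \bar R) A :
  measurable_fun setT T -> (forall B, measurable B -> mu (T @^-1` B) = mu B) ->
  measurable_fun setT f -> (forall x, 0 <= f x)%E -> measurable A ->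
  (\int[mu]_(x in T @^-1` A) f (T x) = \int[mu]_(x in A) f x)%E.
Proof.
move=> mT muT mf f0 mA.
rewrite -(ge0_integral_pushforward mT)//; last exact: measurable_funTS.
by apply: eq_measure_integral => B mB _; exact: muT.
Qed.

Lemma riesz_mass_translation A x : measurable A ->
  (\int[mu]_(xi in A) (K (x - xi))%:E)%E = riesz_mass ((fun u => u + x) @^-1` A).
Proof.
move=> mA.
have mKx : measurable_fun setT (fun xi : 'rV[R]_n => (K (x - xi))%:E).
  rewrite (_ : (fun _ => _) = (fun y => (K y)%:E) \o (fun xi : 'rV[R]_n => xi + (- x))).
    apply: (@measurableT_comp _ _ _ _ _ _ (fun y => (K y)%:E)) => //.
    exact: measurable_translation.
  by apply/funext => y; rewrite /= /riesz_kernel enormB.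
have <- := integral_measure_preserving (measurable_translation x) (@lebesgue_rV_translation R n x)
  mKx (fun y => riesz_kernel_ge0 (x - y)) mA.
apply: eq_integral => y _.
by rewrite opprD addrCA subrr addr0 /riesz_kernel enormN.
Qed.

Lemma riesz_mass_reflection w A : measurable A ->
  riesz_mass (reflection w @^-1` A) = riesz_mass A.
Proof.
move=> mA; rewrite /riesz_mass.
have <- := integral_measure_preserving (measurable_reflection w) (@reflection_lebesgue_rV R n w)
  (@measurable_riesz_kernel setT) riesz_kernel_ge0 mA.
by apply: eq_integral => y _; rewrite /riesz_kernel enorm_reflection.
Qed.

Context (alpha_le : alpha <= 0).

Lemma kernel_exponent_le0 : alpha - n%:R <= 0.
Proof. by rewrite subr_le0 (le_trans alpha_le). Qed.

Lemma riesz_mass_le A a : 0 < a -> measurable A -> (forall x, A x -> a <= enorm x) ->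
  (riesz_mass A <= (a `^ (alpha - n%:R))%:E * mu A)%E.
Proof.
move=> a0 mA Aa; rewrite /riesz_mass -(integral_cst mu mA).
apply: ge0_le_integral => //.
by move=> x Ax; rewrite lee_fin /= nonpos_ler_powR ?kernel_exponent_le0// Aa.
Qed.

Lemma riesz_mass_ge A b : measurable A -> (forall x, A x -> 0 < enorm x <= b) ->
  ((b `^ (alpha - n%:R))%:E * mu A <= riesz_mass A)%E.
Proof.
move=> mA Ab; rewrite /riesz_mass -(integral_cst mu mA).
apply: ge0_le_integral => //; first by move=> x _; rewrite lee_fin powR_ge0.
by move=> x /Ab/andP[x0 xb]; rewrite lee_fin nonpos_ler_powR ?kernel_exponent_le0.
Qed.

(** Away from the origin the kernel is bounded, so bounded sets have finite mass. *)
Lemma riesz_mass_fin A a b : 0 < a -> measurable A ->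
  (forall x, A x -> a <= enorm x <= b) -> riesz_mass A \is a fin_num.
Proof.
move=> a0 mA Aab; rewrite ge0_fin_numE ?riesz_mass_ge0//.
apply: le_lt_trans (riesz_mass_le a0 mA _) _ => [x /Aab/andP[]//|].
rewrite lte_mul_pinfty ?lee_fin ?powR_ge0//.
apply: le_lt_trans (cball_lebesgue_rV_lty b 0).
apply: le_measure; rewrite ?inE//; first exact: measurable_cball.
by move=> x /Aab/andP[_]; rewrite /cball/= subr0.
Qed.

Definition shell (a b : R) : set 'rV[R]_n := cball b 0 `\` cball a 0.

Lemma shellE a b x : shell a b x <-> a < enorm x <= b.
Proof.
rewrite /shell /cball/= subr0; split.
  by move=> [-> /negP]; rewrite -ltNge andbT.
by move=> /andP[ax ->]; split=> //; apply/negP; rewrite -ltNge.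
Qed.

Lemma measurable_shell a b : measurable (shell a b).
Proof. by apply: measurableD; exact: measurable_cball. Qed.

Definition ball_volume : R := fine (mu (cball 1 0)).

Lemma lebesgue_rV_shell a b : 0 < a -> a <= b ->
  mu (shell a b) = ((b ^+ n - a ^+ n) * ball_volume)%:E.
Proof.
move=> a0 ab; have b0 : 0 < b by exact: lt_le_trans ab.
have B1 : mu (cball 1 0) = ball_volume%:E.
  by rewrite fineK// ge0_fin_numE// cball_lebesgue_rV_lty.
rewrite /shell measureD; [|exact: measurable_cball|exact: measurable_cball|
  exact: cball_lebesgue_rV_lty].
rewrite setIidr; last by move=> x; rewrite /cball/= => xa; exact: le_trans xa ab.
have muB r : 0 < r -> mu (cball r 0) = (r ^+ n * ball_volume)%:E.
  by move=> r0; rewrite EFinM -B1; exact: lebesgue_rV_cball.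
rewrite [X in (X - _)%E](muB _ b0) [X in (_ - X)%E](muB _ a0).
by rewrite -EFinB mulrBl.
Qed.

Definition shell_mass a b := fine (riesz_mass (shell a b)).

Lemma shell_mass_fin a b : 0 < a -> riesz_mass (shell a b) \is a fin_num.
Proof.
move=> a0; apply: (@riesz_mass_fin _ a b) => //; first exact: measurable_shell.
by move=> x /shellE/andP[/ltW -> ->].
Qed.

Lemma shell_massD a b c : 0 < a -> a <= b -> b <= c ->
  shell_mass a c = shell_mass a b + shell_mass b c.
Proof.
move=> a0 ab bc; have b0 : 0 < b by exact: lt_le_trans ab.
rewrite /shell_mass -fineD ?shell_mass_fin// -riesz_massU; try exact: measurable_shell.
  congr (fine (riesz_mass _)); apply/seteqP; split => x.
    move=> /shellE/andP[ax xc]; have [xb|xb] := leP (enorm x) b.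
      by left; apply/shellE; rewrite ax.
    by right; apply/shellE; rewrite xb.
  move=> [|] /shellE/andP[h1 h2]; apply/shellE; apply/andP; split=> //.
  - exact: le_trans bc.
  - exact: le_lt_trans h1.
apply/seteqP; split => // x [/shellE/andP[_ h1] /shellE/andP[h2 _]].
by move: (lt_le_trans h2 h1); rewrite ltxx.
Qed.

(** Bounds of the kernel on the shell times its volume. They are tight to first
    order as a and b get close, which is all that the derivative in b needs. *)
Lemma shell_mass_bounds a b : 0 < a -> a <= b ->
  b `^ (alpha - n%:R) * ((b ^+ n - a ^+ n) * ball_volume) <= shell_mass a b <=
  a `^ (alpha - n%:R) * ((b ^+ n - a ^+ n) * ball_volume).
Proof.
move=> a0 ab; have fin := shell_mass_fin b a0.
rewrite -!lee_fin /shell_mass fineK//.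
rewrite (EFinM (b `^ _)) (EFinM (a `^ _)) -lebesgue_rV_shell//.
apply/andP; split.
  apply: riesz_mass_ge; first exact: measurable_shell.
  by move=> x /shellE/andP[/(lt_trans a0) -> ->].
apply: riesz_mass_le => //; first exact: measurable_shell.
by move=> x /shellE/andP[/ltW].
Qed.

End riesz_mass.

(** * The renormalized potential without the limit *)

(** The difference quotient of h is at most that of f, which converges, times an
    increment of g, which tends to 0. *)
Lemma is_derive_0_of_product_bound (R : realType) (f g h : R -> R) (x : R) :
  derivable f x 1 -> derivable g x 1 ->
  (\forall t \near x, `|h t - h x| <= `|f t - f x| * `|g t - g x|) ->
  is_derive x 1 h 0.
Proof.
move=> df dg hfg.
have cg : g t @[t --> x] --> g x.
  by apply: differentiable_continuous; exact/derivable1_diffP.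
have cs : (t *: 1 + x : R) @[t --> (0:R)^'] --> x.
  have : (t *: 1 + x : R) @[t --> (0:R)^'] --> 0 + x; last by rewrite add0r.
  apply: cvg_within_filter; apply: cvgD; last exact: cvg_cst.
  by rewrite (_ : (fun t : R => t *: (1 : R)) = id)//; apply/funext => t; exact: mulr1.
suff H : (t^-1 *: ((h \o shift x) (t *: 1) - h x) @[t --> 0^'] --> (0 : R)).
  by apply: DeriveDef; [apply/cvg_ex; exists 0|exact: cvg_lim].
apply: norm_cvg0.
have F : (`|t^-1 *: ((f \o shift x) (t *: 1) - f x)| * `|(g \o shift x) (t *: 1) - g x|
    @[t --> 0^'] --> `|'D_1 f x| * `|g x - g x|).
  apply: cvgM; first exact: cvg_norm.
  by apply: cvg_norm; apply: cvgB; [exact: cvg_comp cg|exact: cvg_cst].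
rewrite subrr normr0 mulr0 in F.
apply: (squeeze_cvgr _ (cvg_cst 0) F).
have : \forall t \near (0:R)^', `|h (t *: 1 + x) - h x| <=
    `|f (t *: 1 + x) - f x| * `|g (t *: 1 + x) - g x|.
  exact: cs hfg.
apply: filterS => t ht.
by rewrite normr_ge0 /= !normrM -mulrA ler_wpM2l.
Qed.

Section shell_mass_formula.
Context {R : realType} {n : nat}.
Context (alpha : R) (alpha_le : alpha <= 0) (n_gt0 : (0 < n)%N).
Local Notation shell_mass := (@shell_mass R n alpha).
Local Notation omega := (@ball_volume R n).
Local Notation renorm_term := (@renorm_term R n alpha).

(** Polar coordinates in differential form. The increment of the mass differs from
    t^(alpha - n) times the increment of the volume omega s^n by at most the
    product of the increments of s^(alpha - n) and omega s^n. *)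
Lemma is_derive_shell_mass (c t : R) : 0 < c -> c < t ->
  is_derive t 1 (shell_mass c) (n%:R * omega * t `^ (alpha - 1)).
Proof.
move=> c0 ct; have t0 : 0 < t by exact: lt_trans ct.
pose f (s : R) := s `^ (alpha - n%:R).
pose g (s : R) := omega * s `^ n%:R.
have dg : is_derive t 1 g (omega * (n%:R * t `^ (n%:R - 1))).
  by have := is_deriveZ omega (is_derive1_powR n%:R t0); exact.
have gE s : 0 < s -> g s = s ^+ n * omega.
  by move=> s0; rewrite /g powR_mulrn ?ltW// mulrC.
have df : is_derive t 1 f ((alpha - n%:R) * t `^ (alpha - n%:R - 1)).
  exact: is_derive1_powR.
pose h s := shell_mass c s - f t * g s.
have dh : is_derive t 1 h 0.
  apply: (@is_derive_0_of_product_bound _ f g) => //.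
  have /near_in_itvoy : t \in `]c, +oo[ by rewrite in_itv/= ct.
  apply: filterS => s; rewrite in_itv/= andbT => /ltW cs.
  have s0 : 0 < s by exact: lt_le_trans cs.
  have omega0 : 0 <= omega by rewrite fine_ge0.
  rewrite /h.
  have [ts|/ltW st] := leP t s.
    have gts : 0 <= g s - g t.
      by rewrite subr_ge0 ler_wpM2l// ge0_ler_powR ?nnegrE// ltW.
    have fts : 0 <= f t - f s by rewrite subr_ge0 nonpos_ler_powR// kernel_exponent_le0.
    have := @shell_massD R n alpha alpha_le _ _ _ c0 (ltW ct) ts.
    have := @shell_mass_bounds R n alpha alpha_le _ _ t0 ts.
    rewrite -/(f t) -/(f s) mulrBl -!gE// => /andP[h1 h2] ->.
    have := mulr_ge0 fts gts => fg0.
    rewrite (distrC (f s)) (ger0_norm fts) (ger0_norm gts) ler_norml.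
    by apply/andP; split; lra.
  have gst : 0 <= g t - g s.
    by rewrite subr_ge0 ler_wpM2l// ge0_ler_powR ?nnegrE// ltW.
  have fst : 0 <= f s - f t by rewrite subr_ge0 nonpos_ler_powR// kernel_exponent_le0.
  have := @shell_massD R n alpha alpha_le _ _ _ c0 cs st.
  have := @shell_mass_bounds R n alpha alpha_le _ _ s0 st.
  rewrite -/(f t) -/(f s) mulrBl -!gE// => /andP[h1 h2] ->.
  have := mulr_ge0 fst gst => fg0.
  rewrite (distrC (g s)) (ger0_norm fst) (ger0_norm gst) ler_norml.
  by apply/andP; split; lra.
have := is_deriveD dh (is_deriveZ (f t) dg).
rewrite add0r (_ : _ *: _ = n%:R * omega * t `^ (alpha - 1)).
  rewrite (_ : h + _ = shell_mass c)//; apply/funext => s.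
  by rewrite /h fctE; apply: subrK.
have -> : t `^ (alpha - 1) = t `^ (alpha - n%:R) * t `^ (n%:R - 1).
  by rewrite -powRD ?(gt_eqF t0) ?implybT//; congr (_ `^ _); lra.
by rewrite /GRing.scale/= /f; ring.
Qed.

Lemma sphere_area : fine (sphere_measure (@unit_sphere R n)) = n%:R * omega.
Proof.
rewrite sphere_measureE// /ball_volume fineM//.
by rewrite ge0_fin_numE// cball_lebesgue_rV_lty.
Qed.

Lemma is_derive_renorm_term (t : R) : 0 < t ->
  is_derive t 1 renorm_term (- (n%:R * omega * t `^ (alpha - 1))).
Proof.
move=> t0; have [a0|a0] := eqVneq alpha 0.
  have := is_deriveZ (- (n%:R * omega)) (is_derive1_ln t0).
  rewrite (_ : _ *: _ = - (n%:R * omega * t `^ (alpha - 1))); last first.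
    by rewrite a0 sub0r powR_inv1 ?ltW// /GRing.scale/= mulNr.
  move=> dln; apply: near_eq_is_derive dln.
  have /near_in_itvoy : t \in `]0, +oo[ by rewrite in_itv/= t0.
  apply: filterS => s; rewrite in_itv/= andbT => s0.
  by rewrite /Defs.renorm_term a0 eqxx sphere_area div1r lnV// /GRing.scale/= mulNr mulrN.
have := is_deriveZ (n%:R * omega / - alpha) (is_derive1_powR alpha t0).
rewrite (_ : _ \*: _ = renorm_term); last first.
  by apply/funext => s; rewrite /Defs.renorm_term (negbTE a0) sphere_area.
rewrite (_ : _ *: _ = - (n%:R * omega * t `^ (alpha - 1)))//.
by rewrite /GRing.scale/=; field.
Qed.

(** The renormalization is chosen so that it cancels the mass of small balls: the
    left-hand side has derivative 0 in a. *)
Lemma shell_mass_renorm (a b : R) : 0 < a -> a <= b ->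
  shell_mass a b - renorm_term a = - renorm_term b.
Proof.
move=> a0 ab.
pose c := a / 2.
have c0 : 0 < c by rewrite divr_gt0.
have ca : c < a by rewrite ltr_pdivrMr// ltr_pMr// ltr1n.
pose G := shell_mass c \+ renorm_term.
have dG (t : R) : c < t -> is_derive t 1 G 0.
  move=> ct; have t0 := lt_trans c0 ct.
  rewrite -(subrr (n%:R * omega * t `^ (alpha - 1))).
  exact: is_deriveD (is_derive_shell_mass c0 ct) (is_derive_renorm_term t0).
have [||d _] := @MVT_segment _ G (fun=> 0) _ _ ab.
- by move=> t; rewrite in_itv/= => /andP[/(lt_trans ca) ? _]; exact: dG.
- apply: derivable_within_continuous => t; rewrite in_itv/=.
  move=> /andP[/(lt_le_trans ca) ct _].
  by have [] := dG t ct.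
rewrite mul0r => /eqP; rewrite subr_eq0 => /eqP.
rewrite /G /= (@shell_massD R n alpha alpha_le _ _ _ c0 (ltW ca) ab) => h; lra.
Qed.

(** As eps shrinks below s, the mass gained in the shell between eps and s is
    exactly the change of the renormalization: the expression under the limit
    is eventually constant. *)
Lemma riesz_potentialE (Omega : set 'rV[R]_n) x s : measurable Omega ->
  (exists M, forall y, Omega y -> enorm y <= M) -> 0 < s -> cball s x `<=` Omega ->
  riesz_potential alpha Omega x =
  fine (riesz_mass alpha ((fun u => u + x) @^-1` Omega `\` cball s 0)) - renorm_term s.
Proof.
move=> mO [M OM] s0 sO.
pose O := (fun u => u + x) @^-1` Omega.
have mO0 : measurable O by apply: measurable_preimage mO; exact: measurable_translation.
have mOs e : measurable (O `\` cball e 0).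
  by apply: measurableD => //; exact: measurable_cball.
have finO e : 0 < e -> riesz_mass alpha (O `\` cball e 0) \is a fin_num.
  move=> e0; apply: (@riesz_mass_fin _ _ _ alpha_le _ e (M + enorm x)) => // u [Ou].
  rewrite /cball/= subr0 => /negP; rewrite -ltNge => /ltW -> /=.
  rewrite -[u](addrK x); apply: le_trans (ler_enormD _ _) _.
  by rewrite enormN lerD2r OM.
apply: norm_lim_near_cst; near=> eps.
have e0 : 0 < eps by near: eps; exact: nbhs_right_gt.
have es : eps <= s by near: eps; exact: nbhs_right_le.
rewrite /Rintegral riesz_mass_translation; last first.
  by apply: measurableD => //; exact: measurable_cball.
have -> : (fun u => u + x) @^-1` (Omega `\` cball eps x) =
    (O `\` cball s 0) `|` shell eps s.
  apply/seteqP; split => u /=; rewrite /cball/= subr0 addrK.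
    move=> [Ou ue]; have [us|us] := leP (enorm u) s; [right|left].
      by apply/shellE; rewrite us andbT ltNge; exact/negP.
    by split=> //; apply/negP; rewrite -ltNge.
  move=> [[Ou us]|/shellE/andP[ue us]].
    by split=> // ue; apply: us; exact: le_trans es.
  split; last by apply/negP; rewrite -ltNge.
  by apply: sO; rewrite /cball/= addrK.
rewrite riesz_massU//.
- rewrite (fineD (finO _ s0) (shell_mass_fin alpha_le s e0)) -[LHS]addrA.
  by congr (_ + _); exact: shell_mass_renorm.
- exact: measurable_shell.
- apply/seteqP; split=> // u [[_ us] /shellE/andP[_ us']].
  by apply: us; rewrite /cball/= subr0.
Unshelve. all: by end_near. Qed.

(** Monotonicity of the potential, compared with a ball centred at x, whose
    potential is minus the renormalization. *)
Lemma riesz_potential_ge_ball (Omega : set 'rV[R]_n) x s : measurable Omega ->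
  (exists M, forall y, Omega y -> enorm y <= M) -> 0 < s -> cball s x `<=` Omega ->
  - renorm_term s <= riesz_potential alpha Omega x.
Proof.
move=> mO bO s0 sO; rewrite (riesz_potentialE mO bO s0 sO).
by rewrite -[leLHS]add0r lerD2r fine_ge0// riesz_mass_ge0.
Qed.

End shell_mass_formula.

(** * Cones *)

Section cones.
Context {R : realType} {n : nat}.
Implicit Types (u v w x y eta xi : 'rV[R]_n) (kappa s r : R) (delta : \bar R).

(** The form used below: by homogeneity no unit direction has to be exhibited. *)
Lemma open_coneE x v kappa delta xi : open_cone x v kappa delta xi <->
  [/\ 0 < enorm (xi - x), ((enorm (xi - x))%:E < delta)%E &
      cos (kappa / 2) * enorm (xi - x) < dot (xi - x) v].
Proof.
split.
  move=> [rho /= [rho0 rhod] [w [w1 wv]] <-].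
  rewrite addrC addKr enormZ w1 mulr1 gtr0_norm// dotZl; split=> //.
  by rewrite mulrC ltr_pM2l.
move=> [xi0 xid xiv].
exists (enorm (xi - x)) => //=; exists ((enorm (xi - x))^-1 *: (xi - x)).
  split; first by rewrite /unit_sphere/= enormZ gtr0_norm ?invr_gt0// mulVf ?gt_eqF.
  by rewrite dotZl ltr_pdivlMl// mulrC.
by rewrite scalerA divff ?gt_eqF// scale1r subrKC.
Qed.

Lemma open_open_cone x v kappa delta : open (open_cone x v kappa delta).
Proof.
rewrite (_ : open_cone _ _ _ _ = [set xi | 0 < enorm (xi - x)] `&`
  ([set xi | ((enorm (xi - x))%:E < delta)%E] `&`
   [set xi | 0 < dot (xi - x) v - cos (kappa / 2) * enorm (xi - x)])); last first.
  apply/seteqP; split => xi /=; rewrite subr_gt0; first by move=> /open_coneE[].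
  by move=> [? []] ? ?; apply/open_coneE.
apply: openI; last apply: openI.
- exact: open_enorm_exterior.
- case: delta => [d| |].
  + by rewrite (_ : [set _ | _] = [set xi | enorm (xi - x) < d])//; exact: open_enorm_ball.
  + rewrite (_ : [set _ | _] = setT); first exact: openT.
    by apply/seteqP; split => // y _ /=; rewrite ltry.
  + rewrite (_ : [set _ | _] = set0); first exact: open0.
    by apply/seteqP; split.
- apply: (@open_comp _ _ (fun y => dot (y - x) v - cos (kappa / 2) * enorm (y - x))
    [set t | 0 < t]); last exact: open_gt.
  have h1 : continuous (fun y => dot (y - x) v).
    apply: (@continuous_dot _ _ (fun y => y - x) (fun=> v)); last exact: cst_continuous.
    by move=> z; apply: continuousB; [exact: id|exact: cst_continuous].
  have h2 : continuous (fun y => cos (kappa / 2) * enorm (y - x)).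
    move=> z; apply: (@continuousM _ _ (fun=> cos (kappa / 2)) (fun y => enorm (y - x))).
      exact: cst_continuous.
    exact: continuous_enormB.
  by move=> y _; exact: (continuousB (h1 y) (h2 y)).
Qed.

Lemma half_aperture_trig kappa : 0 < kappa <= pi ->
  [/\ 0 <= cos (kappa / 2) < 1, 0 < sin (kappa / 2) &
      sin (kappa / 2) ^+ 2 = 1 - cos (kappa / 2) ^+ 2].
Proof.
move=> /andP[k0 kpi]; have := pi_gt0 R => pi0.
have s0 : 0 < sin (kappa / 2) by apply: sin_gt0_pi; apply/andP; split; lra.
have s2 : sin (kappa / 2) ^+ 2 = 1 - cos (kappa / 2) ^+ 2.
  by have := cos2Dsin2 (kappa / 2); lra.
split=> //; apply/andP; split; first by apply: cos_ge0_pihalf; apply/andP; split; lra.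
have := cos_le1 (kappa / 2); rewrite le_eqVlt => /orP[/eqP c1|//].
by move: s2 s0; rewrite c1 expr1n subrr => /eqP; rewrite sqrf_eq0 => /eqP ->; rewrite !ltxx.
Qed.

(** Otherwise the angle between v and the outer normal u exceeds (pi - kappa) / 2,
    and some direction of the cone has a negative inner product with u; near the
    vertex, the points of the cone in this direction are in the open ball. *)
Lemma cone_axis_angle u v kappa delta s : 0 < kappa <= pi ->
  unit_sphere u -> unit_sphere v -> 0 < s -> (0 < delta)%E ->
  (forall xi, enorm xi < s -> ~ open_cone (s *: u) v kappa delta xi) ->
  sin (kappa / 2) <= dot u v.
Proof.
move=> /half_aperture_trig[/andP[c0 c1] sg0 sgE] u1 v1 s0 d0 avoid.
set sg := sin _ in sg0 sgE *; set c := cos _ in c0 c1 sgE.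
rewrite leNgt; apply/negP => uv.
(* Tilting v away from u by the multiple sg: the result points into the ball, and
   is within the aperture; it would be on the boundary of the cone for b = sg. *)
pose w := v - sg *: u.
have uu := unit_sphere_dot u1; have vv := unit_sphere_dot v1.
pose b := dot u v; have bE : dot u v = b by [].
have b1 : b ^+ 2 <= 1 by have := sqr_dot_le u v; rewrite uu vv mulr1.
have ww : dot w w = 1 - b ^+ 2 + (sg - b) ^+ 2.
  by rewrite !dotE (dotC v u) uu vv bE; ring.
have wu : dot w u = b - sg by rewrite !dotE (dotC v u) uu bE; ring.
have wv : dot w v = 1 - sg * b by rewrite !dotE vv bE.
move: w ww wu wv => w ww wu wv.
have sb : 0 < (sg - b) ^+ 2 by rewrite exprn_gt0// subr_gt0.
have q0 : 0 < enorm w.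
  rewrite enorm_gt0; apply/eqP => w0.
  by move: ww; rewrite w0 -(scale0r w) dotZl mul0r; lra.
have sg1 : sg <= 1.
  have c2 := sqr_ge0 c.
  rewrite -(@expr_le1 _ 2) //; last exact: ltW.
  by rewrite sgE; lra.
have wv_gt : c * enorm w < dot w v.
  have wv0 : 0 < dot w v.
    rewrite wv; have := ler_norm b; nra.
  rewrite -(@ltr_pXn2r _ 2)// ?nnegrE ?mulr_ge0 ?enorm_ge0//; last exact: ltW.
  rewrite exprMn sqr_enorm ww wv (_ : c ^+ 2 = 1 - sg ^+ 2); last by lra.
  have : 0 < sg ^+ 2 * (sg - b) ^+ 2 by rewrite mulr_gt0// exprn_gt0.
  lra.
(* A step t along w stays below the height of the cone, and enters the ball
   as |s u + t w|^2 = s^2 - t (2 s (sg - b) - t |w|^2). *)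
have [t t0 [td ts]] : exists2 t : R, 0 < t &
    ((t * enorm w)%:E < delta)%E /\ t * enorm w ^+ 2 < 2 * s * (sg - b).
  pose a := 2 * s * (sg - b); pose q := enorm w.
  have a0 : 0 < a by rewrite !mulr_gt0// subr_gt0.
  have [d dpos dd] : exists2 d : R, 0 < d & (d%:E <= delta)%E.
    case: delta d0 {avoid} => [d| |]//; first by rewrite lte_fin; exists d.
    by exists 1; rewrite ?leey.
  exists (Num.min (d / (2 * q)) (a / (2 * q ^+ 2))).
    by rewrite lt_min !divr_gt0// mulr_gt0// exprn_gt0.
  split.
    apply: lt_le_trans dd; rewrite lte_fin.
    apply: (@le_lt_trans _ _ (d / (2 * q) * q)).
      by rewrite ler_wpM2r ?enorm_ge0// ge_min lexx.
    by rewrite invfM mulrA mulfVK ?gt_eqF//; lra.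
  apply: (@le_lt_trans _ _ (a / (2 * q ^+ 2) * q ^+ 2)).
    by rewrite ler_wpM2r ?sqr_ge0// ge_min lexx orbT.
  rewrite (_ : _ * _ = a / 2); first by rewrite -/a; lra.
  by field; rewrite gt_eqF.
suff /avoid : enorm (s *: u + t *: w) < s.
  apply; apply/open_coneE; rewrite addrC addKr enormZ dotZl gtr0_norm//; split=> //.
    exact: mulr_gt0.
  by rewrite mulrCA ltr_pM2l.
rewrite -(@ltr_pXn2r _ 2)// ?nnegrE ?enorm_ge0 ?ltW//.
rewrite sqr_enorm !dotE (dotC u w) uu wu -(sqr_enorm w).
have : 0 < t * (2 * s * (sg - b) - t * enorm w ^+ 2) by rewrite mulr_gt0// subr_gt0.
lra.
Qed.

(** The angles of eta with v and of v with u are at most kappa / 2 and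
    pi / 2 - kappa / 2, and their sum is at most pi / 2. In coordinates: split eta
    and u along v and apply Cauchy-Schwarz to the orthogonal parts. *)
Lemma cone_halfspace u v kappa eta : 0 < kappa <= pi ->
  unit_sphere u -> unit_sphere v ->
  sin (kappa / 2) <= dot u v -> cos (kappa / 2) * enorm eta <= dot eta v ->
  0 <= dot eta u.
Proof.
move=> /half_aperture_trig[/andP[c0 c1] sg0 sgE] u1 v1.
set sg := sin _ in sg0 sgE *; set c := cos _ in c0 c1 sgE *.
have uu := unit_sphere_dot u1; have vv := unit_sphere_dot v1.
move=> uv etav; pose a := dot eta v; pose b := dot u v.
have aE : dot eta v = a by []. have bE : dot u v = b by [].
have e0 := enorm_ge0 eta.
have := normr_dot_le (eta - a *: v) (u - b *: v).
have -> : dot (eta - a *: v) (u - b *: v) = dot eta u - a * b.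
  by rewrite !dotE (dotC v u) vv aE bE; ring.
have n1 : enorm (eta - a *: v) <= sg * enorm eta.
  rewrite -(@ler_pXn2r _ 2)// ?nnegrE ?enorm_ge0 ?mulr_ge0 ?(ltW sg0)//.
  rewrite exprMn sgE sqr_enorm !dotE (dotC v eta) vv aE -sqr_enorm.
  have : (c * enorm eta) ^+ 2 <= a ^+ 2.
    by rewrite lerXn2r ?nnegrE ?mulr_ge0// (le_trans _ etav) ?mulr_ge0.
  rewrite exprMn; lra.
have n2 : enorm (u - b *: v) <= c.
  rewrite -(@ler_pXn2r _ 2)// ?nnegrE ?enorm_ge0//.
  rewrite sqr_enorm !dotE (dotC v u) vv uu bE.
  have : sg ^+ 2 <= b ^+ 2 by rewrite lerXn2r ?nnegrE ?(ltW sg0)// (le_trans (ltW sg0)).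
  lra.
have n12 : enorm (eta - a *: v) * enorm (u - b *: v) <= sg * enorm eta * c.
  by rewrite ler_pM ?enorm_ge0.
have ab : c * enorm eta * sg <= a * b by rewrite ler_pM ?mulr_ge0// (ltW sg0).
rewrite ler_norml => /andP[h _]; lra.
Qed.

End cones.

(** * Cones meeting a ball centred at the origin *)

Section cone_mass.
Context {R : realType} {n : nat}.
Context (alpha : R) (alpha_le : alpha <= 0).
Implicit Types (u v w x y xi : 'rV[R]_n) (kappa s r D : R) (delta : \bar R).

Definition cone_mass x v kappa delta D : \bar R :=
  riesz_mass alpha (open_cone x v kappa delta `&` cball D 0).

Lemma measurable_cone_cap x v kappa delta D :
  measurable (open_cone x v kappa delta `&` cball D 0).
Proof.
apply: measurableI; last exact: measurable_cball.
by apply: open_measurable_rV; exact: open_open_cone.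
Qed.

Lemma cone_mass_reflection w x v kappa delta D :
  cone_mass (reflection w x) (reflection w v) kappa delta D = cone_mass x v kappa delta D.
Proof.
rewrite /cone_mass -(riesz_mass_reflection alpha w); last exact: measurable_cone_cap.
congr riesz_mass; apply/seteqP; split => xi [] /=; rewrite /cball/= !subr0 enorm_reflection.
  move=> /open_coneE h xiD; split=> //; apply/open_coneE; move: h.
  have -> : reflection w xi - reflection w x = reflection w (xi - x).
    by rewrite reflectionD -scaleN1r -reflectionZ scaleN1r.
  by rewrite enorm_reflection dot_reflection.
move=> /open_coneE h xiD; split=> //; apply/open_coneE; move: h.
have -> : reflection w xi - reflection w x = reflection w (xi - x).
  by rewrite reflectionD -scaleN1r -reflectionZ scaleN1r.
by rewrite enorm_reflection dot_reflection.
Qed.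

(** The first reflection takes u to u'; the second takes the image of v to v'
    and fixes u', because both have the same inner product with u'. *)
Lemma cone_mass_rotation u v u' v' s kappa delta D :
  unit_sphere u -> unit_sphere v -> unit_sphere u' -> unit_sphere v' ->
  dot u v = dot u' v' ->
  cone_mass (s *: u) v kappa delta D = cone_mass (s *: u') v' kappa delta D.
Proof.
move=> /unit_sphere_dot uu /unit_sphere_dot vv /unit_sphere_dot uu' /unit_sphere_dot vv' uv.
rewrite -(cone_mass_reflection (u - u')) reflectionZ reflection_swap ?uu//.
set v1 := reflection _ v.
have v1v1 : dot v1 v1 = 1 by rewrite dot_reflection.
have uv1 : dot u' v1 = dot u' v'.
  by rewrite -uv -(dot_reflection (u - u') u v) reflection_swap ?uu.
move: v1 v1v1 uv1 => v1 v1v1 uv1.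
rewrite -(cone_mass_reflection (v1 - v')) reflectionZ reflection_swap ?v1v1//.
by rewrite reflection_fix// !dotE uv1 subrr.
Qed.

Lemma cone_mass_fin u v s kappa delta D : 0 < kappa <= pi ->
  unit_sphere u -> unit_sphere v -> sin (kappa / 2) <= dot u v -> 0 < s ->
  cone_mass (s *: u) v kappa delta D \is a fin_num.
Proof.
move=> kpi u1 v1 uv s0.
apply: (@riesz_mass_fin _ _ _ alpha_le _ s D) => //; first exact: measurable_cone_cap.
move=> xi [/open_coneE[_ _ xiv]]; rewrite /cball/= subr0 => ->; rewrite andbT.
have := cone_halfspace kpi u1 v1 uv (ltW xiv).
rewrite !dotE (unit_sphere_dot u1) mulr1 subr_ge0 => /le_trans -> //.
by rewrite -[leRHS]mulr1 -[in leRHS](u1 : enorm u = 1) dot_le.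
Qed.

(** Pulling the vertex towards the origin along the inner normal brings every
    point of the cone closer to the origin, by [cone_halfspace]; the kernel
    increases and no point leaves the ball. So the mass is monotone for
    each axis separately, not only after minimizing over the axes. *)
Lemma le_cone_mass u v s r kappa delta D : 0 < kappa <= pi ->
  unit_sphere u -> unit_sphere v -> sin (kappa / 2) <= dot u v -> 0 < s -> s <= r ->
  (cone_mass (r *: u) v kappa delta D <= cone_mass (s *: u) v kappa delta D)%E.
Proof.
move=> kpi u1 v1 uv s0 sr; have uu := unit_sphere_dot u1.
pose a := (r - s) *: u.
have ra : r *: u = s *: u + a by rewrite /a -scalerDl subrKC.
have closer xi : open_cone (r *: u) v kappa delta (xi + a) ->
    open_cone (s *: u) v kappa delta xi /\ s <= enorm xi <= enorm (xi + a).
  move=> /open_coneE; rewrite ra opprD addrACA subrr addr0 => xiC.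
  split; first exact/open_coneE.
  have [_ _ /ltW/(cone_halfspace kpi u1 v1 uv)] := xiC.
  rewrite !dotE uu mulr1 subr_ge0 => xiu; apply/andP; split.
    apply: le_trans xiu _.
    by rewrite -[leRHS]mulr1 -[in leRHS](u1 : enorm u = 1) dot_le.
  rewrite -(@ler_pXn2r _ 2)// ?nnegrE ?enorm_ge0// !sqr_enorm !dotE uu (dotC u xi).
  have : 0 <= (r - s) * dot xi u by rewrite mulr_ge0 ?subr_ge0// (le_trans (ltW s0)).
  have := sqr_ge0 (r - s); lra.
pose C := open_cone (r *: u) v kappa delta `&` cball D 0.
have mC : measurable C by exact: measurable_cone_cap.
have mS : measurable ((fun xi => xi + a) @^-1` C).
  by apply: measurable_preimage mC; exact: measurable_translation.
have mK : measurable_fun setT (fun xi : 'rV[R]_n => (riesz_kernel alpha xi)%:E).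
  exact: measurable_riesz_kernel.
rewrite /cone_mass /riesz_mass -/C.
have <- := integral_measure_preserving (measurable_translation a) (@lebesgue_rV_translation R n a)
  mK (@riesz_kernel_ge0 R n alpha) mC.
apply: (@le_trans _ _ (riesz_mass alpha ((fun xi => xi + a) @^-1` C))).
  apply: ge0_le_integral => //.
  - by move=> xi _; exact: riesz_kernel_ge0.
  - apply: measurable_funTS.
    apply: (@measurableT_comp _ _ _ _ _ _ (fun y => (riesz_kernel alpha y)%:E)) => //.
    exact: measurable_translation.
  - exact: measurable_riesz_kernel.
  - move=> xi [/closer[_ /andP[sxi xia]] _].
    by rewrite lee_fin nonpos_ler_powR ?kernel_exponent_le0// (lt_le_trans s0).
apply: le_riesz_mass => //; first exact: measurable_cone_cap.
move=> xi [/closer[xiC /andP[_ xia]] xiD]; split=> //.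
by move: xiD; rewrite /cball/= !subr0; exact: le_trans.
Qed.

End cone_mass.

Section base_vectors.
Context {R : realType} {n : nat}.
Context (n_ge2 : (2 <= n)%N).

Lemma dot_row_delta k (x : 'rV[R]_n) (kn : (k < n)%N) :
  dot (\row_(i < n) (i == k :> nat)%:R) x = x 0 (Ordinal kn).
Proof.
rewrite /dot (bigD1 (Ordinal kn))//= big1 => [|i ik].
  by rewrite mxE eqxx mul1r addr0.
by rewrite mxE (_ : (i == k :> nat) = false) ?mul0r//; exact: negbTE.
Qed.

Lemma theta_axis (theta : R) : let v := cos theta *: @e_first R n + sin theta *: e_last in
  [/\ unit_sphere (@e_first R n), unit_sphere v & dot e_first v = cos theta].
Proof.
have n0 : (0 < n)%N by exact: leq_trans n_ge2.
have n1 : (n.-1 < n)%N by rewrite prednK.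
have n10 : (n.-1 == 0)%N = false by move: n_ge2; case: n => [|[]].
have ff : dot (@e_first R n) e_first = 1 by rewrite (dot_row_delta _ n0) mxE.
have ll : dot (@e_last R n) e_last = 1 by rewrite (dot_row_delta _ n1) mxE eqxx.
have fl : dot (@e_first R n) e_last = 0 by rewrite (dot_row_delta _ n0) mxE eq_sym n10.
split.
- exact: dot_unit_sphere.
- apply: dot_unit_sphere; rewrite !dotE (dotC e_last) ff ll fl.
  by have := cos2Dsin2 theta; lra.
- by rewrite !dotE ff fl; ring.
Qed.

End base_vectors.

(** A zero of the defect at r makes each admissible cone with vertex at distance r
    outweigh the shell; monotonicity extends this to the distance s, and rotation
    invariance to cones whose axis is not in the plane of the definition. *)
Lemma shell_mass_le_cone_mass (R : realType) (n : nat) (alpha kappa D R0 r s : R)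
    (delta : \bar R) (u v : 'rV[R]_n) :
  (2 <= n)%N -> alpha <= 0 -> 0 < kappa <= pi -> unit_sphere u -> unit_sphere v ->
  sin (kappa / 2) <= dot u v -> 0 < s -> s <= r ->
  @cone_defect R n alpha kappa delta D R0 r = 0 ->
  @shell_mass R n alpha R0 D <= fine (cone_mass alpha (s *: u) v kappa delta D).
Proof.
move=> n2 a0 kpi u1 v1 uv s0 sr defect0.
have r0 : 0 < r by exact: lt_le_trans sr.
have duv : -1 <= dot u v <= 1.
  by rewrite -ler_norml; have := normr_dot_le u v; rewrite u1 v1 mulr1.
pose theta := acos (dot u v).
have cE : cos theta = dot u v by rewrite acosK ?in_itv.
have [e1 w1 ew] := @theta_axis R n n2 theta.
set w := (_ + _ : 'rV[R]_n) in w1 ew.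
have sw : sin (kappa / 2) <= dot e_first w by rewrite ew cE.
rewrite (cone_mass_rotation alpha s kappa delta D u1 v1 e1 w1); last by rewrite ew cE.
apply: (@le_trans _ _ (fine (cone_mass alpha (r *: e_first) w kappa delta D))); last first.
  by rewrite fine_le ?cone_mass_fin// le_cone_mass.
rewrite -subr_ge0 -defect0; apply: ge_inf.
  exists (- @shell_mass R n alpha R0 D) => _ [t _ <-].
  rewrite -[leLHS]add0r lerD2r; apply: Rintegral_ge0 => *; exact: powR_ge0.
exists theta => //=.
have /andP[k0 kp] := kpi; have pi0 := pi_gt0 R.
rewrite in_itv/= acos_ge0//=.
have phiE : cos ((pi - kappa) / 2) = sin (kappa / 2).
  by rewrite mulrBl cosB cos_pihalf sin_pihalf mul0r add0r mul1r.
rewrite leNgt -ltr_cos ?in_itv/= ?acos_ge0 ?acos_lepi//.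
  by rewrite -leNgt phiE -/theta cE.
by apply/andP; split; lra.
Qed.

(** * The comparison of the two potentials *)

Section bodies.
Context {R : realType} {n : nat}.
Implicit Types (x y z p q : 'rV[R]_n) (A Y : set 'rV[R]_n).

Lemma enorm_bounded_set A M : (forall x, A x -> enorm x <= M) -> bounded_set A.
Proof.
move=> AM; exists M; split; first exact: num_real.
move=> N MN x Ax; rewrite /Num.Def.normr/= mx_normrE.
have xN : enorm x <= N by rewrite (le_trans (AM x Ax))// ltW.
apply/bigmax_leP; split; first by rewrite (le_trans _ xN) ?enorm_ge0.
by move=> [i j] _ /=; rewrite ord1 (le_trans (coor_le_enorm x j)).
Qed.

Lemma enorm_le_diam A M p q : (forall x, A x -> enorm x <= M) -> A p -> A q ->
  enorm (p - q) <= diam A.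
Proof.
move=> AM Ap Aq; apply: ub_le_sup; last by exists (p, q).
exists (M + M) => _ [[p' q'] [/= Ap' Aq'] <-].
by apply: le_trans (ler_enormD _ _) _; rewrite enormN lerD ?AM.
Qed.

(** The distance to the complement is attained on its closure, by compactness, and
    not on the complement, which is open. *)
Lemma nearest_boundary_point Y M y : (0 < n)%N -> closed Y ->
  (forall x, Y x -> enorm x <= M) -> Y° y ->
  [/\ 0 < dist_set y (~` Y),
      forall xi, enorm (xi - y) < dist_set y (~` Y) -> Y xi &
      exists2 z, frontier (~` Y) z & enorm (z - y) = dist_set y (~` Y)].
Proof.
move=> n0 cY YM Yy; set s := dist_set _ _.
have oYC : open (~` Y) by rewrite openC.
have [p Yp] : (~` Y) !=set0.
  exists (const_mx (`|M| + 1)) => /YM.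
  have := coor_le_enorm (const_mx (`|M| + 1) : 'rV[R]_n) (Ordinal n0).
  rewrite mxE ger0_norm ?addr_ge0// => h1 h2; have := ler_norm M; lra.
have s0 : 0 < s.
  have [e e0 eY] := interior_enorm Yy.
  apply: (lt_le_trans e0); apply: lb_le_inf; first by exists (enorm (y - p)), p.
  by move=> _ [a Ya <-]; rewrite leNgt; apply/negP; rewrite enormB => /eY.
split=> //.
  move=> xi xiy; apply: contrapT => nY.
  have := @dist_set_le _ _ y (~` Y) xi nY.
  by rewrite leNgt enormB xiy.
pose K := closure (~` Y) `&` cball (enorm (p - y)) y.
have Kp : K p by split; [exact: subset_closure|rewrite /cball/=].
have cK : compact K.
  apply: bounded_closed_compact; last first.
    by apply: closedI; [exact: closed_closure|exact: closed_cball].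
  apply: (@enorm_bounded_set _ (enorm (p - y) + enorm y)) => x [_ xy].
  by rewrite -[x in enorm x](subrK y) (le_trans (ler_enormD _ _))// lerD2r.
have cf : {within K, continuous (fun xi => enorm (xi - y))}.
  by apply: continuous_subspaceT; exact: continuous_enormB.
have [c] := EVT_min_rV (ex_intro _ p Kp) cK cf.
rewrite inE => -[Yc _] cmin.
have cp : enorm (c - y) <= enorm (p - y) by apply: cmin; rewrite inE.
have cs : enorm (c - y) = s.
  apply/eqP; rewrite eq_le; apply/andP; split.
    apply: lb_le_inf; first by exists (enorm (y - p)), p.
    move=> _ [a Ya <-]; rewrite [leRHS]enormB.
    have [ap|/ltW pa] := leP (enorm (a - y)) (enorm (p - y)); last first.
      exact: le_trans cp pa.
    by apply: cmin; rewrite inE; split=> //; exact: subset_closure.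
  have : closure (~` Y) `<=` [set xi | s <= enorm (xi - y)]; last exact.
  rewrite (closure_id [set xi | s <= enorm (xi - y)]).1.
    by apply: closureS => a Ya; rewrite /= enormB; exact: dist_set_le.
  exact: closed_cball_exterior.
exists c => //; split=> // /interior_subset/= Ync.
have cy0 : c != y.
  by apply/eqP => cy0; move: s0; rewrite -cs cy0 subrr enorm0 ltxx.
by have := dist_set_lt oYC Ync cy0; rewrite -/s enormB cs ltxx.
Qed.

Lemma cball_sub_of_dist_set A x rho : closed A -> A x -> rho <= dist_set x (~` A) ->
  cball rho x `<=` A.
Proof.
move=> cA Ax xA xi xirho; apply: contrapT => nA.
have xix : xi != x by apply/eqP => xix; apply: nA; rewrite xix.
have := dist_set_lt (A := ~` A) _ nA xix; rewrite openC => /(_ cA).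
by rewrite enormB ltNge (le_trans _ xA).
Qed.

(** From a point p, walk through y and on to the far side of the ball around y. *)
Lemma enorm_le_diam_sub A M (u : 'rV[R]_n) y p s : (forall x, A x -> enorm x <= M) ->
  unit_sphere u -> 0 < s -> (forall xi, enorm (xi - y) < s -> A xi) -> A p ->
  enorm (p - y) <= diam A - s / 2.
Proof.
move=> AM u1 s0 yA Ap; set xi := p - y.
have [w [w1 xiw]] : exists w, unit_sphere w /\ xi = enorm xi *: w.
  (* The unit vector u serves as a direction when p = y. *)
  have [->|xi0] := eqVneq xi 0; first by exists u; rewrite enorm0 scale0r.
  have nxi : 0 < enorm xi by rewrite enorm_gt0.
  exists ((enorm xi)^-1 *: xi); rewrite scalerA divff ?gt_eqF// scale1r; split=> //.
  by rewrite /unit_sphere/= enormZ gtr0_norm ?invr_gt0// mulVf ?gt_eqF.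
have s20 : 0 < s / 2 by rewrite divr_gt0.
have Aq : A (y - (s / 2) *: w).
  apply: yA; rewrite addrC addKr enormN enormZ w1 mulr1 gtr0_norm//; lra.
have := enorm_le_diam AM Ap Aq.
have -> : p - (y - (s / 2) *: w) = (enorm xi + s / 2) *: w.
  by rewrite scalerDl -xiw /xi opprB addrA addrAC.
rewrite enormZ w1 mulr1 ger0_norm ?addr_ge0 ?enorm_ge0 ?(ltW s20)//; lra.
Qed.

End bodies.

Theorem theorem3p3 (R : realType) (m : nat) (alpha : R)
    (X Y : set 'rV[R]_m) (kappa : R) (delta : \bar R) (R0 : R)
    (hm : (2 <= m)%N) (halpha : alpha <= 0)
    (hX : body X) (hY : body Y)
    (hkappa : 0 < kappa <= pi) (hdelta : (0 < delta)%E)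
    (hcone : inner_cone_condition (~` Y) kappa delta)
    (hR0 : 0 < R0 < diam Y)
    (x y : 'rV[R]_m)
    (hx : X x) (hxR : R0 <= dist_set x (~` X))
    (hy : Y° y)
    (hyR : dist_set y (~` Y) <= Rtilde m alpha kappa delta (diam Y) R0) :
  riesz_potential alpha Y y < riesz_potential alpha X x.
Proof.
have m0 : (0 < m)%N by exact: leq_trans hm.
have /andP[R00 R0D] := hR0; set D := diam Y in R0D hyR *.
have cX := body_closed hX; have cY := body_closed hY.
have [MX XM] := body_bounded hX; have [MY YM] := body_bounded hY.
have [] := nearest_boundary_point m0 cY YM hy.
set s := dist_set y (~` Y) in hyR * => s0 sY [z zY zs].
(* If the defect had no positive zero, the threshold radius would be the default 0,
   below the positive distance s. *)
have [r sr defect0] : exists2 r, s <= r & @cone_defect R m alpha kappa delta D R0 r = 0.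
  move: hyR; rewrite /Rtilde; case: xgetP => [r _ [r0 dr] sr|_]; first by exists r.
  by rewrite leNgt s0.
pose u := s^-1 *: (z - y).
have u1 : unit_sphere u.
  by rewrite /unit_sphere/= enormZ zs gtr0_norm ?invr_gt0// mulVf ?gt_eqF.
have uu := unit_sphere_dot u1.
have suz : s *: u = z - y by rewrite scalerA divff ?gt_eqF// scale1r.
move: u u1 uu suz => u u1 uu suz.
have [v [v1 coneY]] := hcone z zY.
pose C := open_cone (s *: u) v kappa delta.
pose Y0 := (fun xi => xi + y) @^-1` Y.
have CY0 xi : C xi -> ~ Y0 xi.
  move=> /open_coneE Cxi; apply: coneY; apply/open_coneE; move: Cxi.
  by rewrite suz opprB addrA addrAC.
have ballY0 xi : enorm xi < s -> Y0 xi by move=> xis; apply: sY; rewrite addrK.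
have uv : sin (kappa / 2) <= dot u v.
  apply: (cone_axis_angle hkappa u1 v1 s0 hdelta) => xi /ballY0 Y0xi /CY0; exact.
have C_pos xi : C xi -> 0 < dot xi u.
  move=> /open_coneE[_ _ /ltW/(cone_halfspace hkappa u1 v1 uv)].
  by rewrite !dotE uu mulr1 subr_ge0; exact: lt_le_trans.
have C_far xi : C xi -> s <= enorm xi.
  by move=> /CY0 nY; rewrite leNgt; apply/negP => /ballY0.
pose D' := D - s / 2.
have Y0D xi : Y0 xi -> enorm xi <= D'.
  by move=> Yxi; have := enorm_le_diam_sub YM u1 s0 sY Yxi; rewrite addrK.
have sD' : s / 2 <= D'.
  have : enorm ((s / 2) *: u) <= D'.
    by apply: Y0D; apply: ballY0; rewrite enormZ u1 mulr1 gtr0_norm ?divr_gt0//; lra.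
  by rewrite enormZ u1 mulr1 gtr0_norm ?divr_gt0.
(* Strictness: T has positive mass, lies in B_D, and meets neither Y0 nor the cone,
   which lies on the other side of the hyperplane orthogonal to u. *)
pose T := [set xi | D' < enorm (xi - 0)] `&`
  ([set xi | enorm (xi - 0) < D] `&` [set xi | 0 < dot xi (- u)]).
have oT : open T.
  apply: openI; first exact: open_enorm_exterior.
  apply: openI; first exact: open_enorm_ball.
  apply: (@open_comp _ _ (fun xi : 'rV[R]_m => dot xi (- u)) [set t | 0 < t]).
    move=> xi _; apply: (@continuous_dot _ _ id (fun=> - u)).
      by move=> ?; exact: cvg_id.
    exact: cst_continuous.
  exact: open_gt.
have mT : measurable T by exact: open_measurable_rV.
have T0 : T !=set0.
  have q0 : 0 < D - s / 4 by rewrite /D' in sD'; lra.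
  have qn : enorm ((- (D - s / 4) *: u) - 0) = D - s / 4.
    by rewrite subr0 enormZ u1 normrN mulr1 gtr0_norm.
  exists (- (D - s / 4) *: u); split; first by rewrite /= qn /D'; lra.
  split; first by rewrite /= qn; lra.
  by rewrite /= dotZl dotNr uu mulrN mulr1 opprK.
have TD xi : T xi -> [/\ D' < enorm xi, enorm xi <= D & dot xi u < 0].
  move=> [/= h1 [/= h2 h3]]; rewrite subr0 in h1; rewrite subr0 in h2.
  by rewrite dotNr oppr_gt0 in h3; split=> //; exact: ltW.
have mC : measurable (C `&` cball D 0) by exact: measurable_cone_cap.
have mY0 : measurable Y0.
  by apply: measurable_preimage (closed_measurable_rV cY); exact: measurable_translation.
have s20 : 0 < s / 2 by rewrite divr_gt0.
have mB : measurable (Y0 `\` cball (s / 2) 0).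
  by apply: measurableD => //; exact: measurable_cball.
have finT : riesz_mass alpha T \is a fin_num.
  apply: (riesz_mass_fin halpha s20 mT (b := D)) => xi /TD[/ltW xiD' -> _].
  by rewrite (le_trans sD').
have finC : cone_mass alpha (s *: u) v kappa delta D \is a fin_num.
  exact: cone_mass_fin.
have finB : riesz_mass alpha (Y0 `\` cball (s / 2) 0) \is a fin_num.
  apply: (riesz_mass_fin halpha s20 mB (b := D')) => xi [/Y0D ->].
  by rewrite /cball/= subr0 => /negP; rewrite -ltNge => /ltW ->.
(* Y0 outside a small ball, T, and the cone inside B_D are disjoint parts of a shell. *)
have packing : (riesz_mass alpha (Y0 `\` cball (s / 2) 0) + riesz_mass alpha T +
    cone_mass alpha (s *: u) v kappa delta D <=
    riesz_mass alpha (shell (s / 2) D : set 'rV[R]_m))%E.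
  rewrite -riesz_massU//; last first.
    apply/seteqP; split=> // xi [[/Y0D h _] /TD[/(le_lt_trans h)]].
    by rewrite ltxx.
  rewrite -riesz_massU//; [|exact: measurableU|]; last first.
    apply/seteqP; split=> // xi [[[Y0xi _]|/TD[_ _ h]] [Cxi _]]; first exact: CY0 Y0xi.
    by have := lt_trans (C_pos _ Cxi) h; rewrite ltxx.
  apply: le_riesz_mass; [|exact: measurable_shell|].
    by apply: measurableU => //; exact: measurableU.
  move=> xi H; apply/shellE; move: H => [[[Y0xi xis]|/TD[h1 h2 _]]|[/C_far h1 h2]].
  - apply/andP; split; last by have := Y0D _ Y0xi; rewrite /D'; lra.
    by move: xis; rewrite /cball/= subr0 => /negP; rewrite -ltNge.
  - by rewrite h2 andbT (le_lt_trans sD').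
  - move: h2; rewrite /cball/= subr0 => ->; rewrite andbT; lra.
have real_packing : fine (riesz_mass alpha (Y0 `\` cball (s / 2) 0)) +
    fine (riesz_mass alpha T) + fine (cone_mass alpha (s *: u) v kappa delta D) <=
    @shell_mass R m alpha (s / 2) D.
  have finBT : (riesz_mass alpha (Y0 `\` cball (s / 2) 0) +
      riesz_mass alpha T)%E \is a fin_num.
    by rewrite fin_numD finB finT.
  rewrite -(fineD finB finT) -(fineD finBT finC).
  apply: fine_le packing; last exact: shell_mass_fin.
  by rewrite fin_numD finC andbT.
have VY : riesz_potential alpha Y y + fine (riesz_mass alpha T) +
    fine (cone_mass alpha (s *: u) v kappa delta D) <= - @renorm_term R m alpha D.
  have -> : riesz_potential alpha Y y =
      fine (riesz_mass alpha (Y0 `\` cball (s / 2) 0)) - @renorm_term R m alpha (s / 2).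
    apply: (riesz_potentialE halpha m0 (closed_measurable_rV cY) (ex_intro _ MY YM) s20).
    by move=> xi; rewrite /cball/= => xiy; apply: sY; lra.
  have sD : s / 2 <= D by rewrite /D' in sD'; lra.
  have := shell_mass_renorm halpha m0 s20 sD; lra.
have VX : - @renorm_term R m alpha R0 <= riesz_potential alpha X x.
  apply: (riesz_potential_ge_ball halpha m0 (closed_measurable_rV cX) _ R00).
    by exists MX.
  exact: cball_sub_of_dist_set.
have hC := shell_mass_le_cone_mass hm halpha hkappa u1 v1 uv s0 sr defect0.
have hS := shell_mass_renorm halpha m0 R00 (ltW R0D).
have massT : 0 < fine (riesz_mass alpha T).
  apply: fine_gt0; apply/andP; split; last by rewrite -ge0_fin_numE ?riesz_mass_ge0.
  apply: lt_le_trans (riesz_mass_ge halpha (b := D) mT _).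
    apply: mule_gt0; last exact: open_lebesgue_rV_gt0.
    by rewrite lte_fin powR_gt0// (lt_trans R00).
  by move=> xi /TD[h -> _]; rewrite andbT (lt_trans (lt_le_trans s20 sD') h).
have sum_up (vY vX t c sh gR gD : R) : vY + t + c <= - gD -> - gR <= vX ->
    sh <= c -> sh - gR = - gD -> 0 < t -> vY < vX by clear; lra.
exact: sum_up VY VX hC hS massT.
Qed.
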